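(* In the setting of the context, with $\rho$ the principal eigenvalue defined there, \[ \rho=\inf_{g\in C^2_\gamma(\bar Q)}\ \sup_{\mu\in\mathcal{P}(\bar Q\times\mathcal{K}\times\mathbb{R}^d)}F(g,\mu)=\sup_{\mu\in\mathcal{P}(\bar Q\times\mathcal{K}\times\mathbb{R}^d)}\ \inf_{g\in C^2_\gamma(\bar Q)}F(g,\mu). \] Moreover, these equalities remain valid when $\mathcal{P}(\bar Q\times\mathcal{K}\times\mathbb{R}^d)$ is replaced with $\mathfrak{M}_{\mathcal{A},Q}$, and thus \[ \rho=\sup_{\mu\in\mathfrak{M}_{\mathcal{A},Q}}\int_{\bar Q\times\mathcal{K}\times\mathbb{R}^d}\mathcal{R}(x,\xi,y)\,\mu(\mathrm{d}x,\mathrm{d}\xi,\mathrm{d}y). \]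
   Context: Let $Q\subset\mathbb{R}^d$ be a bounded $C^2$ domain with $0\in Q$, and $\mathcal{K}$ a compact metrizable space. Let $b\colon\bar Q\times\mathcal{K}\to\mathbb{R}^d$ be continuous and Lipschitz in $x$ uniformly in $\xi$; let $\sigma\colon\bar Q\to\mathbb{R}^{d\times d}$ be continuously differentiable with Hölder continuous derivatives, such that the minimum eigenvalue of $a=\sigma\sigma^{\mathsf T}$ is bounded away from zero on $Q$; let $\gamma_i(x)=\sum_j a^{ij}(x)n_j(x)$ on $\partial Q$ be the co-normal direction ($\vec n$ the outward unit normal). Let $c\colon\bar Q\times\mathcal{K}\to\mathbb{R}$ be continuous and Lipschitz in $x$ uniformly in $\xi$. Let $C^2_\gamma(\bar Q)=\{f\in C^2(\bar Q):\langle\nabla f,\gamma\rangle=0\text{ on }\partial Q\}$ and $C^2_{\gamma,+}(\bar Q)$ its nonnegative elements. Let $\mathcal{G}f(x)=\tfrac12\operatorname{tr}(a(x)\nabla^2f(x))+\max_{\xi\in\mathcal{K}}[\langle b(x,\xi),\nabla f(x)\rangle+c(x,\xi)f(x)]$. It is known that there is a unique pair $(\rho,V)\in\mathbb{R}\times C^2_{\gamma,+}(\bar Q)$ with $\mathcal{G}V=\rho V$ in $Q$, $\langle\nabla V,\gamma\rangle=0$ on $\partial Q$, and $V(0)=1$; $\rho$ is this number. Define $\mathcal{R}(x,\xi,y)=c(x,\xi)-\tfrac12|\sigma^{\mathsf T}(x)y|^2$ and $\mathcal{A}\phi(x,\xi,y)=\tfrac12\operatorname{tr}(a(x)\nabla^2\phi(x))+\langle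 b(x,\xi)+a(x)y,\nabla\phi(x)\rangle$ for $\phi\in C^2_\gamma(\bar Q)$. For $g\in C^2_\gamma(\bar Q)$ and $\mu\in\mathcal{P}(\bar Q\times\mathcal{K}\times\mathbb{R}^d)$ (Borel probability measures), $F(g,\mu)=\int(\mathcal{A}g+\mathcal{R})\,\mathrm{d}\mu$. Let $\mathfrak{M}_{\mathcal{A},Q}$ be the set of $\mu\in\mathcal{P}(\bar Q\times\mathcal{K}\times\mathbb{R}^d)$ with $\int|\mathcal{A}f|\,\mathrm{d}\mu<\infty$ and $\int\mathcal{A}f\,\mathrm{d}\mu=0$ for all $f\in C^2_\gamma(\bar Q)$. *)

(* Defs.v *)
From HB Require Import structures.
From mathcomp Require Import all_boot all_order all_algebra.
From mathcomp Require Import all_classical all_reals all_analysis.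
Set Implicit Arguments.
Unset Strict Implicit.
Unset Printing Implicit Defensive.
Import Order.TTheory GRing.Theory Num.Theory.
Import numFieldNormedType.Exports.
Local Open Scope classical_set_scope.
Local Open Scope ring_scope.

Definition dotv (R : realType) (d : nat) (u v : 'rV[R]_d) : R :=
  \sum_(i < d) u 0 i * v 0 i.
Definition sqnorm (R : realType) (d : nat) (v : 'rV[R]_d) : R := dotv v v.
Definition enorm (R : realType) (d : nat) (v : 'rV[R]_d) : R :=
  Num.sqrt (sqnorm v).

(* Topological boundary of a set (closure minus interior; Q will be open). *)
Definition bdry (R : realType) (d : nat) (Q : set 'rV[R]_d) : set 'rV[R]_d :=
  closure Q `\` Q.

Definition C2_on (R : realType) (d : nat) (U : set 'rV[R]_d)
  (f : 'rV[R]_d -> R) (Df : 'rV[R]_d -> 'rV[R]_d)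
  (D2f : 'rV[R]_d -> 'M[R]_d) : Prop :=
  forall x, U x ->
    [/\ differentiable f x, (forall v, 'D_v f x = dotv v (Df x)),
        differentiable Df x, (forall v, 'D_v Df x = v *m D2f x)
      & {for x, continuous D2f}].

(* f in C^1(closure Q) with gradient Df (Q open): C^1 in Q, and f, Df
   extend continuously to closure Q (Df on the boundary is the extension). *)
Definition C1_closure (R : realType) (d : nat) (Q : set 'rV[R]_d)
  (f : 'rV[R]_d -> R) (Df : 'rV[R]_d -> 'rV[R]_d) : Prop :=
  [/\ (forall x, Q x -> [/\ differentiable f x,
                            (forall v, 'D_v f x = dotv v (Df x))
                          & {for x, continuous Df}]),
      {within closure Q, continuous f}
    & {within closure Q, continuous Df}].

Definition C2_closure (R : realType) (d : nat) (Q : set 'rV[R]_d)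
  (f : 'rV[R]_d -> R) (Df : 'rV[R]_d -> 'rV[R]_d)
  (D2f : 'rV[R]_d -> 'M[R]_d) : Prop :=
  [/\ C2_on Q f Df D2f,
      {within closure Q, continuous f},
      {within closure Q, continuous Df}
    & {within closure Q, continuous D2f}].

Definition C2_boundary_normal (R : realType) (d : nat) (Q : set 'rV[R]_d)
  (n : 'rV[R]_d -> 'rV[R]_d) : Prop :=
  forall p, bdry Q p ->
    exists (U : set 'rV[R]_d) (psi : 'rV[R]_d -> R)
           (Dpsi : 'rV[R]_d -> 'rV[R]_d) (D2psi : 'rV[R]_d -> 'M[R]_d),
      [/\ open U, U p, C2_on U psi Dpsi D2psi,
          (forall x, U x -> Dpsi x != 0) &
          Q `&` U = U `&` [set x | psi x < 0]] /\
      n p = (enorm (Dpsi p))^-1 *: Dpsi p.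

Definition amat (R : realType) (d : nat) (sigma : 'rV[R]_d -> 'M[R]_d)
  (x : 'rV[R]_d) : 'M[R]_d := sigma x *m (sigma x)^T.

Definition conormal (R : realType) (d : nat) (sigma : 'rV[R]_d -> 'M[R]_d)
  (n : 'rV[R]_d -> 'rV[R]_d) (x : 'rV[R]_d) : 'rV[R]_d :=
  n x *m (amat sigma x)^T.

(* Triples (f, grad f, Hessian f). *)
Definition C2fun (R : realType) (d : nat) : Type :=
  (('rV[R]_d -> R) * ('rV[R]_d -> 'rV[R]_d) * ('rV[R]_d -> 'M[R]_d))%type.

Definition C2gamma (R : realType) (d : nat) (Q : set 'rV[R]_d)
  (sigma : 'rV[R]_d -> 'M[R]_d) (n : 'rV[R]_d -> 'rV[R]_d) : set (C2fun R d) :=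
  [set g | C2_closure Q g.1.1 g.1.2 g.2 /\
           forall x, bdry Q x -> dotv (g.1.2 x) (conormal sigma n x) = 0].

(* The operator G (max over the compact K written as sup). *)
Definition Gop (R : realType) (d : nat) (K : pseudoPMetricType R)
  (sigma : 'rV[R]_d -> 'M[R]_d) (b : 'rV[R]_d -> K -> 'rV[R]_d)
  (c : 'rV[R]_d -> K -> R) (g : C2fun R d) (x : 'rV[R]_d) : R :=
  2^-1 * \tr (amat sigma x *m g.2 x) +
  sup [set dotv (b x xi) (g.1.2 x) + c x xi * g.1.1 x | xi in [set: K]].

Notation Xspace R d K := ('rV[R]_d * K * 'rV[R]_d)%type.

Notation BorelX R d K := (g_sigma_algebraType (@open (Xspace R d K))).

Definition Dom (R : realType) (d : nat) (K : pseudoPMetricType R)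
  (Q : set 'rV[R]_d) : set (Xspace R d K) :=
  (closure Q `*` [set: K]) `*` [set: 'rV[R]_d].

Arguments Dom {R d} K Q _.

Definition Aop (R : realType) (d : nat) (K : pseudoPMetricType R)
  (sigma : 'rV[R]_d -> 'M[R]_d) (b : 'rV[R]_d -> K -> 'rV[R]_d)
  (g : C2fun R d) (z : Xspace R d K) : R :=
  let x := z.1.1 in let xi := z.1.2 in let y := z.2 in
  2^-1 * \tr (amat sigma x *m g.2 x) +
  dotv (b x xi + y *m (amat sigma x)^T) (g.1.2 x).

Definition Rcost (R : realType) (d : nat) (K : pseudoPMetricType R)
  (sigma : 'rV[R]_d -> 'M[R]_d) (c : 'rV[R]_d -> K -> R)
  (z : Xspace R d K) : R :=
  c z.1.1 z.1.2 - 2^-1 * sqnorm (z.2 *m sigma z.1.1).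

(* P(Qbar x K x R^d): Borel probability measures on the ambient space
   carried by Qbar x K x R^d. *)
Definition Pset (R : realType) (d : nat) (K : pseudoPMetricType R)
  (Q : set 'rV[R]_d) : set (probability (BorelX R d K) R) :=
  [set mu | mu (Dom K Q) = 1%E].

Arguments Pset {R d} K Q _.

Definition Fobj (R : realType) (d : nat) (K : pseudoPMetricType R)
  (Q : set 'rV[R]_d) (sigma : 'rV[R]_d -> 'M[R]_d)
  (b : 'rV[R]_d -> K -> 'rV[R]_d) (c : 'rV[R]_d -> K -> R)
  (g : C2fun R d) (mu : probability (BorelX R d K) R) : \bar R :=
  (\int[mu]_(z in Dom K Q) (Aop sigma b g z + Rcost sigma c z)%:E)%E.

Definition MAQ (R : realType) (d : nat) (K : pseudoPMetricType R)
  (Q : set 'rV[R]_d) (sigma : 'rV[R]_d -> 'M[R]_d)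
  (n : 'rV[R]_d -> 'rV[R]_d) (b : 'rV[R]_d -> K -> 'rV[R]_d)
  : set (probability (BorelX R d K) R) :=
  [set mu | Pset K Q mu /\
     forall g, C2gamma Q sigma n g ->
       (\int[mu]_(z in Dom K Q) (`|Aop sigma b g z|)%:E < +oo)%E /\
       (\int[mu]_(z in Dom K Q) (Aop sigma b g z)%:E = 0)%E].

(* Main.v *)
(** With u = ln V, completing the square in y gives, for x in closure Q,
      A u + R = rho + (r(x, xi) - (1/2) V |sigma^T (y - grad u)|^2) / V,
    where r <= 0 and max_xi r = G V - rho V = 0.  Hence F(u, mu) <= rho for
    every mu, with equality when mu is carried by the compact set S where
    r = 0 and y = grad u.  It remains to find on S a probability measure mu*
    with int A f dmu* = 0 for every f in C^2_gamma.  At a minimum point of f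
    over closure Q the gradient of f vanishes (on the boundary because of the
    co-normal condition) and its Hessian is nonnegative, so A f >= 0 at some
    point of S.  Therefore the functional inf_f sup_S (phi - A f) is finite,
    and a linear functional below it is positive, normalized, and kills every
    A f; it is represented by a regular Borel measure because S is compact.
    That ln V makes sense, i.e. V > 0 on closure Q, is the strong maximum
    principle inside Q and Hopf's lemma, through the interior ball condition,
    on the boundary. *)

Require Import Defs.
From HB Require Import structures.
From mathcomp Require Import all_boot all_order all_algebra.
From mathcomp Require Import all_classical all_reals all_analysis.
From mathcomp Require Import measurable_realfun ring lra.
Import Order.TTheory GRing.Theory Num.Theory.
Import numFieldNormedType.Exports.
Local Open Scope classical_set_scope.
Local Open Scope ring_scope.
Set Implicit Arguments.
Unset Strict Implicit.
Unset Printing Implicit Defensive.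

(** * Dominated linear functionals *)

(** The equalities come from an explicit saddle point: u = ln V bounds F by rho on all of P, and the
    optimal measure gives F = rho for every g. Since that measure lies in the smaller set, one
    argument serves P and its replacement. The variable y is unbounded and the cost is quadratic in
    y, so F may be -oo; compactness holds only on S, which lies in the graph of grad u over the
    compact product of closure Q and K. The dominated functional is taken on all functions bounded
    on S, not just the continuous ones, so that its values on indicators form a finitely additive
    set function. Regularising that set function yields a Borel measure which dominates it on closed
    sets only; this one-sided comparison suffices, because it applies to rescalings of both A f and
    -A f and the total masses agree. For the positivity of V the nonlinear operator is replaced by
    the linear one of a single fixed control: V is a supersolution of it, and V >= 0 allows its
    zeroth-order coefficient to be lowered to a nonpositive constant. *)

Section DominatedExtension.
Variables (R : realType) (E : lmodType R) (D : set E).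
Hypothesis D_add : forall x y, D x -> D y -> D (x + y).
Hypothesis D_scale : forall t x, D x -> D (t *: x).

(** Homogeneity is asked only as an inequality, a form that is stable under infima; scaling back by
    [t^-1] recovers equality for [t > 0]. Everything is relative to [D] because the functional of
    interest is meaningful on bounded functions only. *)
Definition sublinear_on (q : E -> R) : Prop :=
  (forall x y, D x -> D y -> q (x + y) <= q x + q y) /\
  (forall t x, 0 <= t -> D x -> q (t *: x) <= t * q x).

Lemma sublinear_on_ge_opp q x :
  sublinear_on q -> D x -> - q (- x) <= q x.
Proof.
move=> [qD qZ] Dx.
have DNx : D (- x) by rewrite -scaleN1r; exact: D_scale.
have q0 : 0 <= q (0 *: x).
  have := qD _ _ (D_scale 0 Dx) (D_scale 0 Dx).
  by rewrite -scalerDl addr0; lra.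
have := qD _ _ Dx DNx; rewrite subrr -(scale0r x); lra.
Qed.

(** Vanishing outside [D] makes a candidate determined by its values on [D], so that minimality can
    be stated as an equality of functions. *)
Let cand (p : E -> R) (q : E -> R) : Prop :=
  [/\ sublinear_on q, (forall x, D x -> q x <= p x)
    & (forall x, ~ D x -> q x = 0)].

Let cand_lb p q x : cand p q -> D x -> - p (- x) <= q x.
Proof.
move=> [qs qp _] Dx; apply: le_trans (sublinear_on_ge_opp qs Dx).
by rewrite lerN2 qp// -scaleN1r; exact: D_scale.
Qed.

(** Zorn's lemma for the reversed pointwise order. A chain has a pointwise infimum on [D], finite
    because candidates stay above [- p (- x)]; the infimum is subadditive because of two members of
    a chain one is the smaller. *)
Lemma minimal_sublinear_on (p : E -> R) : sublinear_on p ->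
  exists q, cand p q /\
    forall q', cand p q' -> (forall x, q' x <= q x) -> q' = q.
Proof.
move=> [pD pZ].
pose T := {q : E -> R | cand p q}.
pose le (s t : T) : bool := `[< forall x, sval t x <= sval s x >].
have [|||A Atot|q qmin] := @Zorn T le.
- by move=> t; apply/asboolP.
- move=> r s t /asboolP rs /asboolP st; apply/asboolP => x.
  exact: le_trans (st x) (rs x).
- move=> [s Ps] [t Pt] /asboolP st /asboolP ts; apply: eq_exist; apply/funext.
  by move=> x; apply/eqP; rewrite eq_le ts st.
- have [[s0 As0]|A0] := pselect (A !=set0); last first.
    (* The empty chain is bounded by [p] itself, cut off outside [D]. *)
    pose q x := if pselect (D x) then p x else 0.
    have qin x : D x -> q x = p x by rewrite /q; case: pselect.
    have qc : cand p q.
      split; last by move=> x; rewrite /q; case: pselect.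
        split=> [x y Dx Dy|t x t0 Dx].
          by rewrite (qin _ Dx) (qin _ Dy) (qin _ (D_add Dx Dy)) pD.
        by rewrite (qin _ Dx) (qin _ (D_scale t Dx)) pZ.
      by move=> x Dx; rewrite qin.
    exists (exist _ q qc) => s As; exfalso; apply: A0; by exists s.
  pose q x := if pselect (D x) then inf [set sval s x | s in A] else 0.
  have qin x : D x -> q x = inf [set sval s x | s in A].
    by rewrite /q; case: pselect.
  have ne x : [set sval s x | s in A] !=set0 by exists (sval s0 x), s0.
  have lb x : D x -> has_lbound [set sval s x | s in A].
    move=> Dx; exists (- p (- x)) => _ [s As <-].
    by apply: cand_lb => //; exact: svalP.
  have qle s x : A s -> D x -> q x <= sval s x.
    by move=> As Dx; rewrite qin//; apply: ge_inf; [exact: lb|exists s].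
  have qge y x : D x -> (forall s, A s -> y <= sval s x) -> y <= q x.
    move=> Dx h; rewrite qin//; apply: lb_le_inf => // _ [s As <-]; exact: h.
  have qc : cand p q.
    split; last by move=> x; rewrite /q; case: pselect.
      split=> [x y Dx Dy|t x t0 Dx].
        rewrite -lerBlDr; apply: (qge) => // s As.
        rewrite lerBlDr -lerBlDl; apply: (qge _ y) => // s' As'.
        rewrite lerBlDl.
        have [/asboolP ss'|/asboolP s's] := Atot _ _ As As'.
          apply: le_trans (qle _ _ As' (D_add Dx Dy)) _.
          have [[sD _] _ _] := svalP s'.
          by apply: le_trans (sD _ _ Dx Dy) _; rewrite lerD.
        apply: le_trans (qle _ _ As (D_add Dx Dy)) _.
        have [[sD _] _ _] := svalP s.
        by apply: le_trans (sD _ _ Dx Dy) _; rewrite lerD.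
      have := t0; rewrite le0r => /predU1P[->|tgt0].
        rewrite mul0r; apply: le_trans (qle _ _ As0 (D_scale 0 Dx)) _.
        have [[_ sZ] _ _] := svalP s0.
        by apply: le_trans (sZ _ _ (lexx _) Dx) _; rewrite mul0r.
      rewrite -ler_pdivrMl//; apply: (qge) => // s As; rewrite ler_pdivrMl//.
      apply: le_trans (qle _ _ As (D_scale t Dx)) _.
      by have [[_ sZ] _ _] := svalP s; exact: sZ.
    move=> x Dx; apply: le_trans (qle _ _ As0 Dx) _.
    by have [_ sp _] := svalP s0; exact: sp.
  exists (exist _ q qc) => s As; apply/asboolP => x /=.
  have [Dx|nDx] := pselect (D x); first exact: qle.
  have [_ _ ->//] := svalP s.
  by rewrite /q; case: pselect.
exists (sval q); split; first exact: svalP.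
move=> q' cq' q'q.
have q'E : exist _ q' cq' = q by apply: qmin; exact/asboolP.
by rewrite -q'E.
Qed.

(* A minimal sublinear functional is additive: along any y it is bounded below
   by the sublinear functional  inf_(t >= 0) q (x + t y) - t q y. *)
Lemma dominated_linear (p : E -> R) : sublinear_on p ->
  exists L : E -> R,
    [/\ (forall x y, D x -> D y -> L (x + y) = L x + L y),
        (forall t x, D x -> L (t *: x) = t * L x)
      & (forall x, D x -> L x <= p x)].
Proof.
move=> /minimal_sublinear_on[q [[[qD qZ] qp q0] qmin]].
have qs : sublinear_on q by [].
have qadd x y : D x -> D y -> q (x + y) = q x + q y.
  move=> Dx Dy; apply/eqP; rewrite eq_le qD//=.
  pose A z := [set q (z + t *: y) - t * q y | t in [set t : R | 0 <= t]].
  pose r z := if pselect (D z) then inf (A z) else 0.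
  have rin z : D z -> r z = inf (A z) by rewrite /r; case: pselect.
  have Dt z t : D z -> D (z + t *: y).
    by move=> Dz; apply: D_add => //; exact: D_scale.
  have qty t : 0 <= t -> q (t *: y) <= t * q y by move=> t0; exact: qZ.
  have lb z : D z -> has_lbound (A z).
    move=> Dz; exists (- q (- z)) => _ [t /= t0 <-].
    have DNz : D (- z) by rewrite -scaleN1r; exact: D_scale.
    have tz : D (z + t *: y) by exact: Dt.
    have NDtz : D (- (z + t *: y)) by rewrite -scaleN1r; exact: D_scale.
    have h1 := qD _ _ DNz tz.
    move: h1; rewrite addrA addNr add0r => h1.
    have [t0'|tn0] := eqVneq t 0.
      rewrite t0' mul0r scale0r addr0 subr0.
      have := sublinear_on_ge_opp qs Dz; lra.
    have tgt0 : 0 < t by rewrite lt_def tn0.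
    have h2 : t * q y <= q (t *: y).
      rewrite -ler_pdivlMl//.
      have := qZ t^-1 (t *: y) _ (D_scale t Dy).
      by rewrite scalerA mulVf// scale1r invr_ge0 => ->.
    lra.
  have ne z : A z !=set0 by exists (q (z + 0 *: y) - 0 * q y), 0 => /=.
  have rle z t : D z -> 0 <= t -> r z <= q (z + t *: y) - t * q y.
    by move=> Dz t0; rewrite rin//; apply: ge_inf; [exact: lb|exists t].
  have ler z c : D z ->
      (forall t, 0 <= t -> c <= q (z + t *: y) - t * q y) -> c <= r z.
    by move=> Dz h; rewrite rin//; apply: lb_le_inf => // _ [t /= t0 <-]; exact: h.
  have rq z : r z <= q z.
    have [Dz|nDz] := pselect (D z).
      by have := rle z 0 Dz (lexx _); rewrite scale0r addr0 mul0r subr0.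
    by rewrite q0// /r; case: pselect.
  (* [r] is again a candidate and lies below [q], so minimality makes them equal. *)
  have rE : r = q.
    apply: qmin => //; split; last by move=> z; rewrite /r; case: pselect.
      split=> [u v Du Dv|t u t0 Du].
        rewrite -lerBlDr; apply: (ler) => // s s0.
        rewrite lerBlDr -lerBlDl; apply: (ler v) => // s' s'0.
        rewrite lerBlDl.
        apply: le_trans (rle _ _ (D_add Du Dv) (addr_ge0 s0 s'0)) _.
        have := qD _ _ (Dt u s Du) (Dt v s' Dv).
        rewrite scalerDl addrACA; lra.
      have := t0; rewrite le0r => /predU1P[->|tgt0].
        rewrite mul0r; apply: le_trans (rq _) _.
        by apply: le_trans (qZ _ _ (lexx _) Du) _; rewrite mul0r.
      rewrite -ler_pdivrMl//; apply: (ler) => // s s0; rewrite ler_pdivrMl//.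
      have ts0 : 0 <= t * s by rewrite mulr_ge0.
      apply: le_trans (rle _ _ (D_scale t Du) ts0) _.
      have := qZ t _ t0 (Dt u s Du).
      rewrite scalerDr scalerA; lra.
    by move=> z Dz; apply: le_trans (rq z) _; exact: qp.
  (* Taking [t = 1] in the infimum that defines [r x = q x] gives [q x + q y <= q (x + y)]. *)
  have := rle x 1 Dx ler01; rewrite rE scale1r mul1r; lra.
have qzero : q (0 : E) = 0 -> forall x, D x -> q (- x) = - q x.
  move=> q00 x Dx; have DNx : D (- x) by rewrite -scaleN1r; exact: D_scale.
  have := qadd _ _ Dx DNx; rewrite subrr q00; lra.
exists q; split=> // t x Dx.
have q00 : q (0 : E) = 0.
  have D0 : D 0 by rewrite -(scale0r x); exact: D_scale.
  have := qadd _ _ D0 D0; rewrite addr0; lra.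
have pos s z : D z -> 0 < s -> q (s *: z) = s * q z.
  move=> Dz s0; apply/eqP; rewrite eq_le (qZ _ _ (ltW s0) Dz)/=.
  rewrite -ler_pdivlMl//.
  have := qZ s^-1 (s *: z) _ (D_scale s Dz).
  by rewrite scalerA mulVf ?gt_eqF// scale1r invr_ge0 ltW// => ->.
have [t0|t0|->] := ltgtP t 0; last by rewrite scale0r mul0r.
- have Nt0 : 0 < - t by rewrite oppr_gt0.
  have DNx : D (- x) by rewrite -scaleN1r; exact: D_scale.
  by have := pos _ _ DNx Nt0; rewrite scalerN scaleNr opprK qzero// mulrNN.
- exact: pos.
Qed.

End DominatedExtension.

(** * Regular measures from finitely additive set functions *)

(** Lebesgue number: if the ball of radius [r] at [x] lies in [U], any radius below [r / 2] serves
    every point within [r / 2] of [x], and compactness makes the radius uniform. *)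
Lemma compact_ball_sub (R : realType) (T : pseudoMetricType R) (A U : set T) :
  compact A -> open U -> A `<=` U ->
  exists2 e : R, 0 < e & forall x, A x -> ball x e `<=` U.
Proof.
move=> /compact_near_coveringP cA oU AU.
have : \forall e \near 0^'+, A `<=` [set x | ball x e `<=` U].
  apply: cA => x Ax.
  have /nbhs_ballP[r /= r0 rU] : nbhs x U by apply: open_nbhs_nbhs; split=> //; exact: AU.
  exists (ball x (r / 2), [set e | e < r / 2]) => /=.
    split; first by apply: nbhsx_ballx; rewrite divr_gt0.
    by apply: nbhs_right_lt; rewrite divr_gt0.
  move=> [y e] /= [xy er] z yz; apply: rU.
  rewrite (splitr r); apply: ball_triangle xy _.
  exact: le_ball (ltW er) _ yz.
move=> h; near (0 : R)^'+ => e.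
by exists e; [|near: e]; first by near: e; exact: nbhs_right_gt.
Unshelve. all: by end_near. Qed.

Section RegularMeasure.
Variables (R : realType) (T : pseudoPMetricType R) (S : set T) (m : set T -> R).
Hypothesis cS : compact S.
Hypothesis clS : closed S.
Hypothesis m_ge0 : forall A, 0 <= m A.
Hypothesis m_setT : m setT = 1.
Hypothesis m_setU : forall A B, A `&` B = set0 -> m (A `|` B) = m A + m B.
Hypothesis m_setCS : m (~` S) = 0.

Let m_mono A B : A `<=` B -> m A <= m B.
Proof.
move=> AB; rewrite -(setDUK AB) m_setU ?lerDl// .
by rewrite setDE setICA setICr setI0.
Qed.

Let m_set0 : m set0 = 0.
Proof. by have := m_setU (setI0 set0); rewrite setU0; lra. Qed.

Let m_leU A B : m (A `|` B) <= m A + m B.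
Proof.
have -> : A `|` B = A `|` (B `\` A).
  apply/seteqP; split=> x [Ax|]; [by left| |by left|by case; right].
  by move=> Bx; have [|nAx] := pselect (A x); [left|right].
rewrite m_setU; last by rewrite setDE setICA setICr setI0.
by rewrite lerD2l m_mono// => x [].
Qed.

Let m_le1 A : m A <= 1. Proof. by rewrite -m_setT m_mono. Qed.

Let mIS A : m A = m (A `&` S).
Proof.
apply/eqP; rewrite eq_le andbC m_mono//=.
have {1}-> : A = (A `&` S) `|` (A `&` ~` S) by rewrite -setIUr setUCr setIT.
apply: le_trans (m_leU _ _) _; rewrite -[leRHS]addr0 lerD//.
by rewrite -m_setCS m_mono.
Qed.

(** [m] need not be countably additive. Approximating open sets from inside by closed sets, which
    are compact within [S], restores countable subadditivity. *)
Let inner (U : set T) : R := sup [set m C | C in [set C | closed C /\ C `<=` U]].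

Let inner_has_sup U : has_sup [set m C | C in [set C | closed C /\ C `<=` U]].
Proof.
split; first by exists (m set0), set0 => //; split; [exact: closed0|].
by exists 1 => _ [C _ <-].
Qed.

Let le_inner U C : closed C -> C `<=` U -> m C <= inner U.
Proof.
by move=> clC CU; apply: ub_le_sup; [case: (inner_has_sup U)|exists C].
Qed.

Let inner_le U r : (forall C, closed C -> C `<=` U -> m C <= r) -> inner U <= r.
Proof.
move=> h; apply: ge_sup; first by case: (inner_has_sup U).
by move=> _ [C [clC CU] <-]; exact: h.
Qed.

Let inner_ge0 U : 0 <= inner U.
Proof. by rewrite -m_set0; apply: le_inner => //; exact: closed0. Qed.

(** The part of a closed [C] in [S] outside [W] is compact, so the closure of some neighbourhood [B]
    of it stays in [U]; what remains of [C] in [S] outside the interior of [B] is closed and lies in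
    [W]. *)
Let inner_setU U W : open U -> open W -> inner (U `|` W) <= inner U + inner W.
Proof.
move=> oU oW; apply: inner_le => C clC CUW.
have cA : compact ((C `&` S) `\` W).
  apply: (subclosed_compact _ cS); last by move=> x [[]].
  by rewrite setDE; apply: closedI; [exact: closedI|exact: open_closedC].
have [|e e0 eU] := compact_ball_sub cA oU.
  by move=> x [[/CUW[]// Wx _]].
pose B := \bigcup_(x in (C `&` S) `\` W) ball x (e / 2).
have BU : closure B `<=` U.
  move=> y By; have e20 : 0 < e / 2 by rewrite divr_gt0.
  have [z [[x Ax xz] yz]] := By _ (nbhsx_ballx y _ e20).
  apply: (eU x Ax); rewrite (splitr e); apply: ball_triangle xz _.
  exact: ball_sym.
rewrite mIS; apply: le_trans (_ : m ((C `&` closure B) `|` ((C `&` S) `\` interior B)) <= _).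
  apply: m_mono => x [Cx Sx].
  have [Bx|nBx] := pselect (B° x); last by right.
  by left; split => //; apply: subset_closure; exact: interior_subset.
apply: le_trans (m_leU _ _) _; rewrite lerD//; apply: le_inner.
- by apply: closedI => //; exact: closed_closure.
- by move=> x [_ /BU].
- rewrite setDE; apply: closedI; first exact: closedI.
  by apply: open_closedC; exact: open_interior.
move=> x [[Cx Sx] nBx]; have [//|nWx] := pselect (W x).
exfalso; apply: nBx; rewrite /interior /=.
have e20 : 0 < e / 2 by rewrite divr_gt0.
apply: filterS (nbhsx_ballx x _ e20) => y xy.
by exists x.
Qed.

Let inner_bigsetU (U : (set T)^nat) n : (forall i, open (U i)) ->
  inner (\big[setU/set0]_(i < n) U i) <= \sum_(i < n) inner (U i).
Proof.
move=> oU; elim: n => [|n ih].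
  rewrite !big_ord0; apply: inner_le => C _; rewrite subset0 => ->.
  by rewrite m_set0.
rewrite !big_ord_recr/=; apply: le_trans (inner_setU _ _) _ => //.
  by rewrite -bigcup_mkord; apply: bigcup_open => i _.
by rewrite lerD2r.
Qed.

(** Compactness of [C] within [S] reduces the countable union to a finite one. *)
Let inner_bigcup (U : (set T)^nat) : (forall i, open (U i)) ->
  ((inner (\bigcup_i U i))%:E <= \sum_(i <oo) (inner (U i))%:E)%E.
Proof.
move=> oU.
have Uge0 n : (0 <= (inner (U n))%:E)%E by rewrite lee_fin.
have [->|fin] := eqVneq (\sum_(i <oo) (inner (U i))%:E)%E +oo%E; first by rewrite leey.
have /fineK <- : (\sum_(i <oo) (inner (U i))%:E)%E \is a fin_num.
  by rewrite ge0_fin_numE ?ltey//; apply: nneseries_ge0.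
rewrite lee_fin; apply: inner_le => C clC CU.
have /compact_near_coveringP cA : compact (C `&` S).
  by apply: (subclosed_compact _ cS) => //; exact: closedI.
have : \forall n \near \oo, C `&` S `<=` [set x | (\big[setU/set0]_(i < n) U i) x].
  apply: cA => x [/CU[i _ Uix] _].
  exists (U i, [set n | (i < n)%N]) => /=.
    by split; [exact: open_nbhs_nbhs|exists i.+1].
  move=> [y n] /= [Uiy iltn]; rewrite -bigcup_mkord; by exists i.
move=> [n _ /(_ n (leqnn n))] h.
rewrite mIS; apply: le_trans (_ : inner (\big[setU/set0]_(i < n) U i) <= _).
  by apply: le_inner => //; exact: closedI.
apply: le_trans (inner_bigsetU n oU) _.
rewrite -lee_fin fineK; last first.
  by rewrite ge0_fin_numE ?ltey//; apply: nneseries_ge0.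
rewrite -sumEFin -(big_mkord xpredT (fun i => (inner (U i))%:E)).
exact: nneseries_lim_ge.
Qed.

Definition outer_of (A : set T) : \bar R :=
  ereal_inf [set (inner U)%:E | U in [set U | open U /\ A `<=` U]].

Let outer_le A U : open U -> A `<=` U -> (outer_of A <= (inner U)%:E)%E.
Proof. by move=> oU AU; apply: ereal_inf_lbound; exists U. Qed.

Let outer_ge0 A : (0 <= outer_of A)%E.
Proof. by apply: le_ereal_inf_tmp => _ [U _ <-]; rewrite lee_fin. Qed.

Let outer_fin A : outer_of A \is a fin_num.
Proof.
rewrite ge0_fin_numE//; apply: le_lt_trans (outer_le openT _) (ltry _) => //.
Qed.

Let outer0 : outer_of set0 = 0%E.
Proof.
apply/eqP; rewrite eq_le outer_ge0 andbT.
apply: le_trans (outer_le open0 _) _ => //; rewrite lee_fin.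
by apply: inner_le => C _; rewrite subset0 => ->; rewrite m_set0.
Qed.

Let outer_mono : {homo outer_of : A B / A `<=` B >-> (A <= B)%E}.
Proof.
move=> A B AB; apply: le_ereal_inf_tmp => _ [U [oU BU] <-].
by apply: outer_le => // x /AB/BU.
Qed.

Let outer_subadd : sigma_subadditive outer_of.
Proof.
move=> F; apply/lee_addgt0Pr => e e0.
have hU i : exists U, [/\ open U, F i `<=` U &
    ((inner U)%:E <= outer_of (F i) + (e / (2 ^ i.+1)%:R)%:E)%E].
  have d0 : 0 < e / (2 ^ i.+1)%:R by rewrite divr_gt0// ltr0n expn_gt0.
  have [_ [U [oU FU] <-] h] := lb_ereal_inf_adherent d0 (outer_fin (F i)).
  by exists U; split => //; exact: ltW.
have [U hU'] := choice hU.
apply: le_trans (_ : ((inner (\bigcup_i U i))%:E <= _)%E).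
  apply: outer_le; first by apply: bigcup_open => i _; case: (hU' i).
  by move=> x [i _ Fx]; exists i => //; have [_ FU _] := hU' i; exact: FU.
apply: le_trans (inner_bigcup _) _; first by move=> i; case: (hU' i).
apply: le_trans (epsilon_trick _ _ (ltW e0)) => //.
apply: lee_nneseries => i _; first by rewrite lee_fin.
by case: (hU' i).
Qed.

(** For an open [W] containing [X] and a closed [C] in [W] and [U], the open set [W] minus [C]
    contains [X] minus [U]. A closed [D] inside it is disjoint from [C], so [m C + m D <= inner W];
    both closed sets are then varied. *)
Let outer_open_car (om : {outer_measure set T -> \bar R}) :
  (om : set T -> \bar R) = outer_of -> forall U, open U -> om.-caratheodory U.
Proof.
move=> omE U oU; apply: le_caratheodory_measurable => X; rewrite omE.
apply: le_ereal_inf_tmp => _ [W [oW XW] <-].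
have oWU : open (W `&` U) by exact: openI.
have : (outer_of (X `&` U) <= (inner (W `&` U))%:E)%E.
  by apply: outer_le => // x [/XW].
rewrite -(fineK (outer_fin (X `&` U))) -(fineK (outer_fin (X `&` ~` U))).
set r := fine (outer_of (X `&` ~` U)); set s := fine _.
rewrite -EFinD !lee_fin => sle.
suff : inner (W `&` U) <= inner W - r by lra.
apply: inner_le => C clC CWU.
suff : r <= inner W - m C by lra.
have rle : r <= inner (W `\` C).
  rewrite -lee_fin fineK ?outer_fin//; apply: outer_le.
    by rewrite setDE; apply: openI => //; exact: closed_openC.
  by move=> x [/XW Wx nUx]; split => // /CWU[].
apply: le_trans rle _; apply: inner_le => D clD DWC.
rewrite lerBrDr -m_setU; last first.
  by rewrite -subset0 => x [/DWC[_ ?]].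
by apply: le_inner; [exact: closedU|move=> x [/DWC[]//|/CWU[]]].
Qed.

(** A closed [C] is admissible in [inner U] for every open [U] containing it, which gives the
    inequality. Equality may fail: [m] can vanish at a point at which the regular measure
    concentrates. *)
Lemma finitely_additive_regular_measure :
  exists mu : probability (g_sigma_algebraType (@open T)) R,
    mu S = 1%E /\ forall C, closed C -> ((m C)%:E <= mu C)%E.
Proof.
pose om : {outer_measure set T -> \bar R} := HB.pack outer_of
  (isOuterMeasure.Build R T outer_of outer0 outer_ge0 outer_mono outer_subadd).
have bc (A : set T) : <<s (@open T) >> A -> om.-caratheodory A.
  apply: smallest_sub => //; last first.
    by move=> U oU; exact: outer_open_car.
  split.
  - exact: caratheodory_measurable_set0.
  - by move=> B mB; rewrite setTD; exact: caratheodory_measurable_setC.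
  - by move=> F mF; exact: caratheodory_measurable_bigcup.
pose X := g_sigma_algebraType (@open T).
have sadd : semi_sigma_additive (outer_of : set X -> \bar R).
  move=> F mF tF mUF.
  apply: (@caratheodory_measure_sigma_additive R T om F) => //.
    by move=> i; apply: bc; exact: mF.
  by apply: bc; exact: mUF.
have cle C : closed C -> ((m C)%:E <= outer_of C)%E.
  move=> clC; apply: le_ereal_inf_tmp => _ [U [oU CU] <-].
  by rewrite lee_fin; exact: le_inner.
have le1 A : (outer_of A <= 1)%E.
  apply: le_trans (outer_le openT _) _ => //.
  by rewrite lee_fin; apply: inner_le => C _ _.
have setT1 : outer_of setT = 1%E.
  apply/eqP; rewrite eq_le le1/= -m_setT; exact: cle closedT.
pose mu : {measure set X -> \bar R} := HB.pack (outer_of : set X -> \bar R)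
  (isMeasure.Build _ X R outer_of outer0 outer_ge0 sadd).
pose P : probability X R := HB.pack (outer_of : set X -> \bar R)
  (Measure.on mu) (Measure_isProbability.Build _ X R mu setT1).
exists P; split; last exact: cle.
apply/eqP; rewrite eq_le le1/=.
apply: le_trans (cle _ clS).
by rewrite lee_fin -m_setT mIS setTI.
Qed.

End RegularMeasure.

(** * Probability measures annihilating a space of functions *)

Lemma closed_within_preimage (T U : topologicalType) (A : set T) (f : T -> U)
    (B : set U) :
  closed A -> {within A, continuous f} -> closed B -> closed (A `&` f @^-1` B).
Proof.
move=> clA /continuous_closedP cf /cf/closed_subspaceP[C clC CE].
by rewrite setIC -CE; exact: closedI.
Qed.

Lemma within_continuous_measurable (R : realType) (T : ptopologicalType)
    (A : set T) (f : T -> R) :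
  closed A -> {within A, continuous f} ->
  measurable_fun (A : set (g_sigma_algebraType (@open T))) f.
Proof.
move=> clA cf; apply: (measurability _ (RGenOInfty.measurableE R)) => _ [B [x ->] <-].
have := closed_within_preimage clA cf (@closed_le R x).
set C := A `&` _ => clC.
have -> : A `&` f @^-1` `]x, +oo[ = A `\` C.
  apply/seteqP; split=> z /=; rewrite in_itv/= andbT.
    by move=> [Az xz]; split => // -[_ /=]; rewrite leNgt xz.
  move=> [Az nC]; split=> //; rewrite ltNge; apply/negP => zx; exact: nC.
rewrite setDE; apply: measurableI; last first.
  by apply: sub_sigma_algebra; exact: closed_openC.
rewrite -(setCK A); apply: measurableC.
by apply: sub_sigma_algebra; exact: closed_openC.
Qed.

(** The sum counts the integers from 1 to [n] not exceeding [x], so it is the integer part of [x].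
    Applied to [N * phi x], it approximates [phi] by indicators of superlevel sets. *)
Lemma staircase_bounds (R : realType) (x : R) (n : nat) :
  0 <= x -> x <= n%:R ->
  \sum_(k < n) (k.+1%:R <= x)%R%:R <= x :> R /\
  x <= 1 + \sum_(k < n) (k.+1%:R <= x)%R%:R :> R.
Proof.
move=> x0 xn.
have h1 : forall i, \sum_(k < i) (k.+1%:R <= x)%R%:R <= x :> R /\
    \sum_(k < i) (k.+1%:R <= x)%R%:R <= i%:R :> R.
  elim=> [|i [ih1 ih2]]; first by rewrite big_ord0.
  rewrite big_ord_recr/= -natr1.
  by case: (leP (i%:R + 1) x) => ix /=; rewrite ?natr1 ?addr0; split; lra.
have h2 : forall i, (i%:R <= x -> \sum_(k < i) (k.+1%:R <= x)%R%:R = i%:R :> R) /\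
    (x <= i%:R -> x <= 1 + \sum_(k < i) (k.+1%:R <= x)%R%:R).
  elim=> [|i [ih1 ih2]]; first by rewrite big_ord0; split => // ; lra.
  rewrite big_ord_recr/= -natr1.
  case: (leP (i%:R + 1) x) => ix /=.
    have -> : \sum_(k < i) (k.+1%:R <= x)%R%:R = i%:R :> R by apply: ih1; lra.
    by split=> //; lra.
  rewrite addr0; split; first lra.
  move=> _; have [ix'|ix'] := leP i%:R x; last by apply: ih2; exact: ltW.
  by rewrite ih1//; lra.
by split; [exact: (h1 n).1|exact: (h2 n).2].
Qed.

Section AnnihilatingMeasure.
Variables (R : realType) (T : pseudoPMetricType R) (S : set T).
Variable L : set (T -> R).
Hypothesis cS : compact S.
Hypothesis clS : closed S.
Hypothesis L_neq0 : L !=set0.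
Hypothesis L_add : forall f g, L f -> L g -> L (fun x => f x + g x).
Hypothesis L_scale : forall t f, L f -> L (fun x => t * f x).
Hypothesis L_cont : forall f, L f -> {within S, continuous f}.
Hypothesis L_pos : forall f, L f -> exists2 z, S z & 0 <= f z.

Let E := (T -> R^o) : lmodType R.
(** All functions bounded on [S], not only the continuous ones, so that indicators belong to the
    domain of the functional. *)
Let D : set E := [set f | exists M : R, forall x, S x -> `|f x| <= M].

Let D_add (f g : E) : D f -> D g -> D (f + g).
Proof.
move=> [M fM] [N gN]; exists (M + N) => x Sx.
by apply: le_trans (ler_normD _ _) _; rewrite lerD ?fM ?gN.
Qed.

Let D_scale t (f : E) : D f -> D (t *: f).
Proof.
move=> [M fM]; exists (`|t| * M) => x Sx.
by rewrite /= normrM ler_wpM2l// fM.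
Qed.

Let D_cont (f : E) : {within S, continuous f} -> D f.
Proof.
move=> cf; have [M [_ h]] := compact_bounded (continuous_compact cf cS).
exists (M + 1) => x Sx; apply: (h (M + 1)); [by rewrite ltrDl|by exists x].
Qed.

(** The infimum [p f] of this set is the infimum over [l] in [L] of the supremum of [f - l] over
    [S]. *)
Let majorants (f : E) : set R := [set t | exists2 l, L l & forall x, S x -> f x <= t + l x].
Let p (f : E) : R := inf (majorants f).

Let L0 : L (fun=> 0).
Proof.
have [f Lf] := L_neq0; have := L_scale 0 Lf.
by congr L; apply/funext => x; rewrite mul0r.
Qed.

Let majorants_lb f M : (forall x, S x -> - M <= f x) -> lbound (majorants f) (- M).
Proof.
move=> fM t [l Ll h].
(* Applied to [- l], the hypothesis gives a point [z] of [S] with [l z <= 0], whence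
   [- M <= f z <= t]. *)
have [z Sz] := L_pos (L_scale (-1) Ll).
have := h z Sz; have := fM z Sz; lra.
Qed.

Let majorants_has_inf f : D f -> has_inf (majorants f).
Proof.
move=> [M fM]; split.
  exists M; exists (fun=> 0) => // x Sx; rewrite addr0.
  by apply: le_trans (ler_norm _) _; exact: fM.
exists (- M); apply: majorants_lb => x Sx; have := fM x Sx; rewrite ler_norml; lra.
Qed.

Let p_le f t : D f -> majorants f t -> p f <= t.
Proof. by move=> Df Pt; apply: ge_inf => //; have [] := majorants_has_inf Df. Qed.

Let le_p f t : D f -> (forall s, majorants f s -> t <= s) -> t <= p f.
Proof. by move=> Df h; apply: lb_le_inf => //; have [] := majorants_has_inf Df. Qed.

Let p_sublinear : sublinear_on D p.
Proof.
split=> [f g Df Dg|t f t0 Df].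
  rewrite -lerBlDr; apply: le_p => // s [l Ll hl].
  rewrite lerBlDr -lerBlDl; apply: le_p => // s' [l' Ll' hl'].
  rewrite lerBlDl; apply: p_le; first exact: D_add.
  exists (fun x => l x + l' x); first exact: L_add.
  by move=> x Sx; apply: le_trans (lerD (hl x Sx) (hl' x Sx)) _; rewrite addrACA.
have := t0; rewrite le0r => /predU1P[->|tgt0].
  rewrite mul0r; apply: p_le; first exact: D_scale.
  by exists (fun=> 0) => // x Sx; rewrite scale0r addr0.
rewrite -ler_pdivrMl//; apply: le_p => // s [l Ll hl]; rewrite ler_pdivrMl//.
apply: p_le; first exact: D_scale.
exists (fun x => t * l x); first exact: L_scale.
by move=> x Sx; rewrite -mulrDr ler_wpM2l// hl.
Qed.

(** All properties are read off upper bounds for [p]: the choice [l = 0] gives positivity and, at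
    the constants 1 and -1, normalisation; the choices [l] and [- l] bound the functional by 0 on
    both. *)
Let functional_exists : exists La : E -> R,
  [/\ (forall f g, D f -> D g -> La (f + g) = La f + La g),
      (forall t f, D f -> La (t *: f) = t * La f),
      (forall f g, D f -> D g -> (forall x, S x -> f x <= g x) -> La f <= La g),
      La (cst 1) = 1
    & forall l, L l -> La l = 0].
Proof.
have [La [LaD LaZ Lap]] := dominated_linear D_add D_scale p_sublinear.
have neg f : D f -> (forall x, S x -> f x <= 0) -> La f <= 0.
  move=> Df f0; apply: le_trans (Lap _ Df) _; apply: p_le => //.
  by exists (fun=> 0) => // x Sx; rewrite addr0 f0.
have D1 : D (cst 1) by exists 1 => x _; rewrite normr1.
have DN f : D f -> D (- f) by rewrite -scaleN1r; exact: D_scale.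
have LaN f : D f -> La (- f) = - La f.
  by move=> Df; rewrite -scaleN1r LaZ// mulN1r.
exists La; split => //.
- move=> f g Df Dg fg; rewrite -subr_le0 -LaN// -LaD//; last exact: DN.
  apply: neg; first by apply: D_add => //; exact: DN.
  by move=> x Sx; rewrite subr_le0 fg.
- apply/eqP; rewrite eq_le; apply/andP; split.
    apply: le_trans (Lap _ D1) _; apply: p_le => //.
    by exists (fun=> 0) => // x Sx; rewrite addr0.
  rewrite -lerN2 -LaN//; apply: le_trans (Lap _ (DN _ D1)) _.
  apply: p_le; first exact: DN.
  by exists (fun=> 0) => // x Sx; rewrite addr0.
- have le0 l : L l -> La l <= 0.
    move=> Ll; have Dl : D l by apply: D_cont; exact: L_cont.
    apply: le_trans (Lap _ Dl) _; apply: p_le => //.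
    by exists l => // x Sx; rewrite add0r.
  move=> l Ll; have Dl : D l by apply: D_cont; exact: L_cont.
  apply/eqP; rewrite eq_le le0//= -oppr_le0 -LaN//.
  rewrite -scaleN1r; apply: le0; exact: (L_scale (-1) Ll).
Qed.

(** A continuous [phi] with values in [[0, 1]] is, up to [1 / N], an average of indicators of closed
    superlevel sets, on which [m] is below [mu]; hence [La phi] is at most the integral of [phi].
    Rescalings of [l] and [- l] turn this into two opposite inequalities. *)
Lemma annihilating_probability :
  exists mu : probability (g_sigma_algebraType (@open T)) R,
    mu S = 1%E /\
    forall l, L l -> (\int[mu]_(x in S) (l x)%:E = 0)%E.
Proof.
have [La [LaD LaZ Lamono La1 LaL]] := functional_exists.
have Dind A : D (\1_A : T -> R).
  by exists 1 => x _; rewrite indicE; case: (x \in A); rewrite ?normr1 ?normr0.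
have D1 : D (cst 1) by exists 1 => x _; rewrite normr1.
have D0 : D 0 by rewrite -(scale0r (cst 1 : E)); exact: D_scale.
have La0 : La 0 = 0 by rewrite -(scale0r (cst 1 : E)) LaZ// mul0r.
pose m (A : set T) : R := La (\1_A : T -> R).
have m_ge0 A : 0 <= m A.
  by rewrite -La0; apply: Lamono => // x _; rewrite indicE.
have m_setT : m setT = 1.
  by rewrite /m indicT.
have m_setU A B : A `&` B = set0 -> m (A `|` B) = m A + m B.
  move=> AB; rewrite /m -LaD//; congr La; apply/funext => x.
  rewrite -[RHS]/(\1_A x + \1_B x) !indicE in_setU.
  have [xA|xA] := boolP (x \in A) => /=.
    have -> : (x \in B) = false; last by rewrite addr0.
    apply/negP => xB; have : (A `&` B) x by split; exact: set_mem.
    by rewrite AB.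
  by rewrite add0r.
have m_setCS : m (~` S) = 0.
  apply/eqP; rewrite eq_le m_ge0 andbT -La0; apply: Lamono => // x Sx.
  by rewrite indicE memNset.
have [mu [muS muC]] :=
  finitely_additive_regular_measure cS clS m_ge0 m_setT m_setU m_setCS.
pose X := g_sigma_algebraType (@open T).
have clmeas (C : set T) : closed C -> measurable (C : set X).
  move=> clC; rewrite -(setCK C); apply: measurableC.
  by apply: sub_sigma_algebra; exact: closed_openC.
have mS : measurable (S : set X) by exact: clmeas.
exists mu; split => //.
have key (phi : T -> R) : {within S, continuous phi} ->
    (forall x, S x -> 0 <= phi x <= 1) ->
    ((La phi)%:E <= \int[mu]_(x in S) (phi x)%:E)%E.
  move=> cphi phi01; have Dphi := D_cont cphi.
  have mphi : measurable_fun (S : set X) (EFin \o (phi : X -> R)).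
    by apply/measurable_EFinP; exact: within_continuous_measurable.
  have int_ge0 : (0 <= \int[mu]_(x in S) (phi x)%:E)%E.
    by apply: integral_ge0 => x Sx; rewrite lee_fin; have /andP[] := phi01 _ Sx.
  have int_fin : (\int[mu]_(x in S) (phi x)%:E)%E \is a fin_num.
    rewrite ge0_fin_numE//.
    apply: le_lt_trans (_ : (\int[mu]_(x in S) (cst 1%:E x) < _)%E); last first.
      by rewrite integral_cst// [X in (_ * X)%E]muS mule1 ltry.
    apply: ge0_le_integral => // [x Sx|x Sx]; rewrite lee_fin;
      by have /andP[] := phi01 _ Sx.
  apply/lee_addgt0Pr => e e0.
  rewrite -(fineK int_fin) -EFinD lee_fin.
  set r := fine _.
  pose N := (Num.truncn e^-1).+1.
  have Ngt0 : 0 < N%:R :> R by rewrite ltr0n.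
  have NVe : N%:R^-1 <= e.
    rewrite -[e]invrK lef_pV2 ?posrE ?invr_gt0//.
    exact/ltW/truncnS_gt.
  suff : La phi <= N%:R^-1 + r by lra.
  (* The levels start at [1 / N], not at 0, so that the staircase lies below [phi]; it misses [phi]
     by at most [1 / N]. *)
  pose C k : set T := S `&` phi @^-1` [set t | k.+1%:R / N%:R <= t].
  have clC k : closed (C k).
    by apply: closed_within_preimage => //; exact: closed_ge.
  pose st n : T -> R := fun x => N%:R^-1 * \sum_(k < n) \1_(C k) x.
  have CE x k : S x -> \1_(C k) x = (k.+1%:R <= N%:R * phi x)%R%:R :> R.
    move=> Sx; rewrite indicE; congr (nat_of_bool _)%:R.
    rewrite mulrC -ler_pdivrMr//; apply/idP/idP => [/set_mem[]//|h].
    by apply/mem_set; split.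
  have bounds x : S x -> st N x <= phi x /\ phi x <= N%:R^-1 + st N x.
    move=> Sx; have /andP[p0 p1] := phi01 _ Sx.
    have x0 : 0 <= N%:R * phi x by rewrite mulr_ge0// ltW.
    have xN : N%:R * phi x <= N%:R by rewrite ger_pMr.
    have := staircase_bounds x0 xN.
    have -> : \sum_(k < N) (k.+1%:R <= N%:R * phi x)%R%:R =
       \sum_(k < N) \1_(C k) x :> R.
      by apply: eq_bigr => k _; rewrite CE.
    rewrite /st; set s := \sum_(_ < _) _ => -[s1 s2]; split.
      by rewrite ler_pdivrMl.
    have -> : N%:R^-1 + N%:R^-1 * s = N%:R^-1 * (1 + s) by rewrite mulrDr mulr1.
    by rewrite ler_pdivlMl.
  have Lst n : D (fun x => \sum_(k < n) \1_(C k) x) /\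
      La (fun x => \sum_(k < n) \1_(C k) x) = \sum_(k < n) m (C k).
    elim: n => [|n [ihD ih]].
      have -> : (fun x => \sum_(k < 0) \1_(C k) x : R) = 0.
        by apply/funext => x; rewrite big_ord0.
      by rewrite big_ord0.
    have -> : (fun x => \sum_(k < n.+1) \1_(C k) x : R) =
        ((fun x => \sum_(k < n) \1_(C k) x) : E) + (\1_(C n) : T -> R).
      by apply/funext => x; rewrite big_ord_recr.
    split; first exact: D_add.
    by rewrite big_ord_recr/= LaD// ih.
  have Dst : D (st N) by apply: (@D_scale N%:R^-1); exact: (Lst N).1.
  have Last : La (st N) = N%:R^-1 * \sum_(k < N) m (C k).
    by rewrite -(Lst N).2 -LaZ//; exact: (Lst N).1.
  apply: le_trans (_ : La (N%:R^-1 *: (cst 1 : E) + (st N : E)) <= _).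
    apply: Lamono => //; first by apply: D_add => //; exact: D_scale.
    move=> x Sx; have [_ h] := bounds x Sx.
    by rewrite -[X in _ <= X]/(N%:R^-1 * 1 + st N x) mulr1.
  rewrite LaD//; last exact: D_scale.
  rewrite LaZ// La1 mulr1 lerD2l Last.
  rewrite -lee_fin /r fineK//.
  apply: le_trans (_ : (\int[mu]_(x in S) (st N x)%:E <= _)%E); last first.
    apply: ge0_le_integral => //.
    - move=> x Sx; rewrite lee_fin; apply: mulr_ge0; first by rewrite invr_ge0 ltW.
      by apply: sumr_ge0 => k _; rewrite indicE.
    - apply/measurable_EFinP; apply: measurable_funM => //.
      apply: measurable_sum => k; apply: measurable_indic; exact: clmeas.
    - by move=> x Sx; rewrite lee_fin; have [] := bounds x Sx.
  under eq_integral do rewrite EFinM.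
  have msum : measurable_fun (S : set X)
      (EFin \o (fun x : X => \sum_(k < N) \1_(C k) x : R)).
    apply/measurable_EFinP.
    apply: measurable_sum => k; apply: measurable_indic; exact: clmeas.
  have sum_ge0 x : S x -> (0 <= (\sum_(k < N) \1_(C k) x)%:E :> \bar R)%E.
    by move=> Sx; rewrite lee_fin; apply: sumr_ge0 => k _; rewrite indicE.
  rewrite ge0_integralZl// ?lee_fin ?invr_ge0 ?(ltW Ngt0)//.
  rewrite EFinM lee_wpmul2l ?lee_fin ?invr_ge0 ?(ltW Ngt0)//.
  under eq_integral do rewrite -sumEFin.
  have mind (k : 'I_N) : measurable_fun (S : set X)
      (EFin \o (\1_(C k) : X -> R)).
    by apply/measurable_EFinP; apply: measurable_indic; exact: clmeas.
  rewrite ge0_integral_sum//.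
  rewrite -sumEFin; apply: lee_sum => k _.
  rewrite integral_indic//; last exact: clmeas.
  have -> : C k `&` S = C k by rewrite /C setIAC setIid.
  exact: muC.
have Lint s : L s -> mu.-integrable S (EFin \o s).
  move=> Ls; have cs := L_cont Ls; have [M hs] := D_cont cs.
  apply: (@measurable_bounded_integrable _ X R mu) => //.
  - by rewrite [X in (X < _)%E]muS ltry.
  - exact: within_continuous_measurable.
  - exists M; split; first exact: num_real.
    by move=> y My x Sx; apply: le_trans (ltW My); exact: hs.
move=> l Ll.
have Dl : D l by apply: D_cont; exact: L_cont.
have [M0 hM0] := Dl.
pose M := `|M0| + 1.
have Mgt0 : 0 < M by rewrite ltr_pwDr.
have hM x : S x -> - M <= l x <= M.
  move=> Sx; rewrite -ler_norml; apply: le_trans (hM0 x Sx) _.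
  by rewrite /M; have := ler_norm M0; lra.
have half s : L s -> (forall x, S x -> - M <= s x <= M) ->
    (0 <= \int[mu]_(x in S) (s x)%:E)%E.
  move=> Ls hs; have cs := L_cont Ls.
  (* Maps [[- M, M]] onto [[0, 1]]. As [La] kills [s], [La phi = 1 / 2], whereas the integral of
     [phi] is 1/2 plus that of [s] divided by [2 * M]; so [key] makes the latter nonnegative. *)
  pose phi x := (2 * M)^-1 * (M + s x).
  have M2 : 0 < 2 * M by rewrite mulr_gt0.
  have cphi : {within S, continuous phi}.
    move=> x; apply: cvgM; first exact: cvg_cst.
    by apply: cvgD; [exact: cvg_cst|exact: cs].
  have phi01 x : S x -> 0 <= phi x <= 1.
    move=> Sx; have /andP[s1 s2] := hs x Sx; apply/andP; split.
      by apply: mulr_ge0; [rewrite invr_ge0 ltW|lra].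
    by rewrite ler_pdivrMl//; lra.
  have sint := Lint _ Ls.
  have := key _ cphi phi01.
  have -> : La phi = 2^-1.
    have -> : phi = (2 * M)^-1 *: (M *: (cst 1 : E) + (s : E)).
      apply/funext => x.
      by rewrite -[RHS]/((2 * M)^-1 * (M * 1 + s x)) mulr1.
    have Ds : D s by exact: D_cont.
    have DM := D_scale M D1.
    rewrite (LaZ _ _ (D_add DM Ds)) (LaD _ _ DM Ds) (LaZ _ _ D1) (LaL _ Ls) La1.
    have Mn0 : M != 0 by rewrite gt_eqF.
    by field.
  have -> : (\int[mu]_(x in S) (phi x)%:E = (2 * M)^-1%:E *
      (M%:E + \int[mu]_(x in S) (s x)%:E))%E.
    under eq_integral do rewrite EFinM.
    have cint := finite_measure_integrable_cst mu M mS.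
    have Msint : mu.-integrable S (EFin \o (fun x => M + s x)).
      exact: (integrableD mS cint sint).
    rewrite integralZl//; congr (_ * _)%E.
    under eq_integral do rewrite EFinD.
    rewrite (integralD mS cint sint).
    by rewrite (integral_cst mu mS M%:E) [X in (_ * X)%E]muS mule1.
  have ifin := integrable_fin_num mS sint.
  rewrite -(fineK ifin) -EFinD -EFinM !lee_fin.
  rewrite ler_pdivlMl//; lra.
apply/eqP; rewrite eq_le half// andbT.
have := half _ (L_scale (-1) Ll).
have -> : (\int[mu]_(x in S) (-1 * l x)%:E = - \int[mu]_(x in S) (l x)%:E)%E.
  under eq_integral do rewrite EFinM.
  by rewrite integralZl// ?mulN1e//; exact: Lint.
rewrite oppe_ge0; apply => x Sx; have := hM x Sx; lra.
Qed.

End AnnihilatingMeasure.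

(** * Euclidean algebra and matrix limits *)

Section EuclideanAlgebra.
Variables (R : realType) (d : nat).
Implicit Types (u v w : 'rV[R]_d) (A B : 'M[R]_d).

Lemma dotvC u v : dotv u v = dotv v u.
Proof. by apply: eq_bigr => i _; rewrite mulrC. Qed.

Lemma dotvDl u v w : dotv (u + v) w = dotv u w + dotv v w.
Proof. by rewrite -big_split; apply: eq_bigr => i _; rewrite mxE mulrDl. Qed.

Lemma dotvDr u v w : dotv u (v + w) = dotv u v + dotv u w.
Proof. by rewrite dotvC dotvDl !(dotvC u). Qed.

Lemma dotvZl t u v : dotv (t *: u) v = t * dotv u v.
Proof. by rewrite /dotv big_distrr/=; apply: eq_bigr => i _; rewrite mxE mulrA. Qed.

Lemma dotvZr t u v : dotv u (t *: v) = t * dotv u v.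
Proof. by rewrite dotvC dotvZl dotvC. Qed.

Lemma dotvNl u v : dotv (- u) v = - dotv u v.
Proof. by rewrite -scaleN1r dotvZl mulN1r. Qed.

Lemma dotvNr u v : dotv u (- v) = - dotv u v.
Proof. by rewrite dotvC dotvNl dotvC. Qed.

Lemma dotv0l v : dotv 0 v = 0.
Proof. by rewrite -(scale0r v) dotvZl mul0r. Qed.

Lemma dotv0r v : dotv v 0 = 0.
Proof. by rewrite dotvC dotv0l. Qed.

Lemma dotvE u v : dotv u v = (u *m v^T) 0 0.
Proof. by rewrite mxE; apply: eq_bigr => i _; rewrite mxE. Qed.

Lemma dotv_mulmxl u A v : dotv (u *m A) v = dotv u (v *m A^T).
Proof. by rewrite !dotvE trmx_mul trmxK mulmxA. Qed.

Lemma sqnorm_ge0 v : 0 <= sqnorm v.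
Proof. by apply: sumr_ge0 => i _; rewrite -expr2 sqr_ge0. Qed.

Lemma sqnorm_eq0 v : sqnorm v = 0 -> v = 0.
Proof.
move=> /eqP; rewrite psumr_eq0; last by move=> i _; rewrite -expr2 sqr_ge0.
move=> /allP h; apply/rowP => i; rewrite mxE.
by have := h i (mem_index_enum i); rewrite mulf_eq0 orbb => /eqP.
Qed.

Lemma sqnormZ t v : sqnorm (t *: v) = t ^+ 2 * sqnorm v.
Proof. by rewrite /sqnorm dotvZl dotvZr mulrA. Qed.

Lemma sqnormN v : sqnorm (- v) = sqnorm v.
Proof. by rewrite -scaleN1r sqnormZ sqrrN expr1n mul1r. Qed.

Lemma sqnormD u v : sqnorm (u + v) = sqnorm u + 2 * dotv u v + sqnorm v.
Proof. by rewrite /sqnorm dotvDl !dotvDr (dotvC v u); lra. Qed.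

Lemma sqnorm_gt0 v : v != 0 -> 0 < sqnorm v.
Proof.
move=> v0; rewrite lt_def sqnorm_ge0 andbT; apply: contra_neq v0.
exact: sqnorm_eq0.
Qed.

Lemma normr_coord m n (M : 'M[R]_(m, n)) i j : `|M i j| <= `|M|.
Proof.
rewrite [leRHS]mx_normrE.
exact: (le_bigmax _ (fun ij => `|M ij.1 ij.2|) (i, j)).
Qed.

(** The norm of row vectors is the maximum norm, hence the factor [d]; it is bounded by the
    Euclidean norm, as used throughout for estimates through [sqnorm]. *)
Lemma dotv_le u v : `|dotv u v| <= d%:R * (`|u| * `|v|).
Proof.
apply: le_trans (ler_norm_sum _ _ _) _.
apply: le_trans (_ : \sum_(i < d) (`|u| * `|v|) <= _); last first.
  by rewrite sumr_const card_ord mulr_natl.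
apply: ler_sum => i _; rewrite normrM.
by apply: ler_pM => //; exact: normr_coord.
Qed.

Lemma normr_sqnorm v : `|v| ^+ 2 <= sqnorm v.
Proof.
have -> : `|v| = mx_norm v by [].
have [->|] := eqVneq (mx_norm v) 0; first by rewrite expr0n/= sqnorm_ge0.
move=> /mx_norm_neq0[[i j] ->]; rewrite (ord1 i) real_normK ?num_real//=.
rewrite /sqnorm /dotv (bigD1 j)//= -expr2 lerDl.
by apply: sumr_ge0 => k _; rewrite -expr2 sqr_ge0.
Qed.

(** The trace becomes a sum of values of the quadratic form of [A] along the columns of [s], so a
    nonnegative Hessian gives a nonnegative second-order term. *)
Lemma mxtrace_quad (s : 'M[R]_d) A :
  \tr (s *m s^T *m A) = \sum_k dotv (row k s^T *m A) (row k s^T).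
Proof.
rewrite -mulmxA mxtrace_mulC -[\tr _]/(\sum_k (s^T *m A *m s) k k).
apply: eq_bigr => k _; rewrite dotvE -row_mul mxE; rewrite mxE.
by apply: eq_bigr => j _; rewrite !mxE.
Qed.

Lemma mxtrace_outer A u : \tr (A *m (u^T *m u)) = dotv (u *m A) u.
Proof.
rewrite mulmxA mxtrace_mulC mulmxA dotvE /mxtrace big_ord1.
by [].
Qed.

Lemma amat_quad (s : 'rV[R]_d -> 'M[R]_d) x v :
  dotv (v *m amat s x) v = sqnorm (v *m s x).
Proof. by rewrite /amat mulmxA dotv_mulmxl trmxK. Qed.

Lemma amat_sym (s : 'rV[R]_d -> 'M[R]_d) x : (amat s x)^T = amat s x.
Proof. by rewrite /amat trmx_mul trmxK. Qed.

End EuclideanAlgebra.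

Section MatrixConvergence.
Variables (R : realType) (T : Type) (F : set_system T).
Context {FF : Filter F}.

Lemma cvg_mx_entries m n (f : T -> 'M[R]_(m, n)) (l : 'M[R]_(m, n)) :
  (forall i j, f x i j @[x --> F] --> l i j) -> f @ F --> l.
Proof.
move=> h; apply/cvg_ballP => e e0.
have : \forall x \near F, forall ij : 'I_m * 'I_n, ball (l ij.1 ij.2) e (f x ij.1 ij.2).
  apply: (@filter_forall _ _ (fun ij x => ball (l ij.1 ij.2) e (f x ij.1 ij.2))).
  by move=> -[i j] /=; have /cvg_ballP := h i j; exact.
apply: filterS => x hx; split; first exact: e0.
by move=> i j; exact: (hx (i, j)).
Qed.

Lemma cvg_sumr (I : Type) (r : seq I) (f : I -> T -> R) (l : I -> R) :
  (forall i, f i @ F --> l i) ->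
  \sum_(i <- r) f i x @[x --> F] --> \sum_(i <- r) l i.
Proof.
move=> h; elim: r => [|i r ih].
  by rewrite big_nil; under eq_fun do rewrite big_nil; exact: cvg_cst.
by rewrite big_cons; under eq_fun do rewrite big_cons; exact: cvgD.
Qed.

Lemma cvg_mx_coord m n (f : T -> 'M[R]_(m, n)) (l : 'M[R]_(m, n)) i j :
  f @ F --> l -> f x i j @[x --> F] --> l i j.
Proof. by move=> h; exact: (cvg_comp _ _ h (@coord_continuous _ _ _ i j l)). Qed.

Lemma cvg_mulmx m n p (f : T -> 'M[R]_(m, n)) (g : T -> 'M[R]_(n, p))
    (a : 'M[R]_(m, n)) (b : 'M[R]_(n, p)) :
  f @ F --> a -> g @ F --> b -> f x *m g x @[x --> F] --> a *m b.
Proof.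
move=> fa gb; apply: cvg_mx_entries => i j.
under eq_fun do rewrite mxE.
rewrite mxE; apply: cvg_sumr => k.
by apply: cvgM; exact: cvg_mx_coord.
Qed.

Lemma cvg_trmx m n (f : T -> 'M[R]_(m, n)) (a : 'M[R]_(m, n)) :
  f @ F --> a -> (f x)^T @[x --> F] --> a^T.
Proof.
move=> fa; apply: cvg_mx_entries => i j.
under eq_fun do rewrite mxE.
by rewrite mxE; exact: cvg_mx_coord.
Qed.

Lemma cvg_mxtrace n (f : T -> 'M[R]_n) (a : 'M[R]_n) :
  f @ F --> a -> \tr (f x) @[x --> F] --> \tr a.
Proof. by move=> fa; apply: cvg_sumr => k; exact: cvg_mx_coord. Qed.

Lemma cvg_dotv n (f g : T -> 'rV[R]_n) (a b : 'rV[R]_n) :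
  f @ F --> a -> g @ F --> b -> dotv (f x) (g x) @[x --> F] --> dotv a b.
Proof.
by move=> fa gb; apply: cvg_sumr => k; apply: cvgM; exact: cvg_mx_coord.
Qed.

End MatrixConvergence.

Lemma sqnorm_continuous (R : realType) (d : nat) (y : 'rV[R]_d) :
  continuous (fun x : 'rV[R]_d => sqnorm (x - y)).
Proof.
move=> x.
have h : (z - y) @[z --> x] --> x - y.
  exact: (@cvgB R 'rV[R]_d 'rV[R]_d (nbhs x) _ (fun z => z) (fun=> y)
    x y cvg_id (cvg_cst _)).
have h2 := h; exact: (cvg_dotv h h2).
Qed.

(** * Derivatives along rays *)

Section DirectionalDerivatives.
Variable R : realType.

Lemma is_derive_cvg (V W : normedModType R) (f : V -> W) (a v : V) (l : W) :
  h^-1 *: (f (h *: v + a) - f a) @[h --> 0^'] --> l -> is_derive a v f l.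
Proof.
by move=> fl; split; [exact: (cvgP l)|exact: cvg_lim].
Qed.

Lemma derivable_quotient_cvg (V W : normedModType R) (f : V -> W) (a v : V) :
  derivable f a v -> h^-1 *: (f (h *: v + a) - f a) @[h --> 0^'] --> 'D_v f a.
Proof. by move=> df; exact: df. Qed.

Lemma is_derive_line (V W : normedModType R) (f : V -> W) (x v : V) (t : R) :
  derivable f (x + t *: v) v ->
  is_derive t 1 (fun s => f (x + s *: v)) ('D_v f (x + t *: v)).
Proof.
move=> /derivable_quotient_cvg df; apply: is_derive_cvg.
suff -> : (fun h => h^-1 *: (f (x + (h *: 1 + t) *: v) - f (x + t *: v))) =
  (fun h => h^-1 *: (f (h *: v + (x + t *: v)) - f (x + t *: v))) by [].
by apply/funext => h; rewrite [h *: 1]mulr1 scalerDl addrCA.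
Qed.

Lemma is_derive_dotv (V : normedModType R) (d : nat) (F : V -> 'rV[R]_d)
    (u : 'rV[R]_d) (a v : V) :
  derivable F a v -> is_derive a v (fun z => dotv u (F z)) (dotv u ('D_v F a)).
Proof.
move=> /derivable_quotient_cvg dF; apply: is_derive_cvg.
suff -> : (fun h => h^-1 *: (dotv u (F (h *: v + a)) - dotv u (F a))) =
    (fun h => dotv u (h^-1 *: (F (h *: v + a) - F a))).
  by apply: cvg_dotv => //; exact: cvg_cst.
by apply/funext => h; rewrite dotvZr dotvDr dotvNr.
Qed.

Lemma is_derive_coord (V : normedModType R) (m n : nat) (F : V -> 'M[R]_(m, n))
    (a v : V) i j :
  derivable F a v -> is_derive a v (fun z => F z i j) ('D_v F a i j).
Proof.
move=> /derivable_quotient_cvg dF; apply: is_derive_cvg.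
suff -> : (fun h => h^-1 *: (F (h *: v + a) i j - F a i j)) =
    (fun h => (h^-1 *: (F (h *: v + a) - F a)) i j).
  exact: cvg_mx_coord.
by apply/funext => h; rewrite !mxE.
Qed.

(** Differentiability is asked for [t > 0] only, with continuity from the right at 0: along a ray
    from a boundary point, derivatives are available only inside the domain. *)
Lemma lt_of_derive_lt0 (phi psi : R -> R) (T : R) :
  (forall t, 0 < t < T -> is_derive t 1 phi (psi t)) ->
  phi t @[t --> 0^'+] --> phi 0 ->
  (forall t, 0 < t < T -> psi t < 0) ->
  forall t, 0 < t < T -> phi t < phi 0.
Proof.
move=> dphi cphi neg t /andP[t0 tT].
have inT s : s \in `]0, t] -> 0 < s < T.
  by rewrite in_itv/= => /andP[s0 st]; rewrite s0/= (le_lt_trans st).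
have ct s : 0 < s < T -> {for s, continuous phi}.
  move=> /dphi[ds _]; apply: differentiable_continuous.
  exact/derivable1_diffP.
have [||s s0t] := @MVT R phi psi 0 t t0.
- move=> s; rewrite in_itv/= => /andP[s0 st].
  by apply: dphi; rewrite s0/= (lt_trans st).
- apply/continuous_within_itvP => //; split=> //.
    move=> s; rewrite in_itv/= => /andP[s0 st].
    by apply: ct; rewrite s0/= (lt_trans st).
  apply: cvg_at_left_filter; apply: ct; by rewrite t0.
rewrite subr0 => E.
have /neg : 0 < s < T.
  by move: s0t; rewrite in_itv/= => /andP[s0 st]; rewrite s0/= (lt_trans st).
by move=> psi0; rewrite -subr_lt0 E nmulr_rlt0.
Qed.

Lemma right_min_derive_ge0 (phi psi : R -> R) (T : R) : 0 < T ->
  (forall t, 0 < t < T -> is_derive t 1 phi (psi t)) ->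
  phi t @[t --> 0^'+] --> phi 0 -> psi t @[t --> 0^'+] --> psi 0 ->
  (forall t, 0 < t < T -> phi 0 <= phi t) -> 0 <= psi 0.
Proof.
move=> T0 dphi cphi cpsi hmin; rewrite leNgt; apply/negP => psi0.
have : \forall t \near 0^'+, psi t < 0 by exact: (cvgr_lt _ cpsi).
move=> [e /= e0 he].
pose T' := Num.min e T.
have T'0 : 0 < T' by rewrite lt_min e0.
have T'T : T' <= T by rewrite ge_min lexx orbT.
have sub s : 0 < s < T' -> 0 < s < T.
  by move=> /andP[-> sT]/=; exact: lt_le_trans T'T.
have t0 : 0 < T' / 2 < T' by apply/andP; split; lra.
suff : phi (T' / 2) < phi 0 by rewrite ltNge hmin// sub.
apply: (@lt_of_derive_lt0 _ psi T') => //.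
  by move=> t /sub; exact: dphi.
move=> t /andP[t1 t2]; apply: he => //=.
rewrite sub0r normrN gtr0_norm//; apply: lt_le_trans t2 _.
by rewrite ge_min lexx.
Qed.

(** A negative [chi 0] would push [psi] below [psi 0 = 0] just after 0, and then [phi] below
    [phi 0]. *)
Lemma right_min_derive2_ge0 (phi psi chi : R -> R) (T : R) : 0 < T ->
  (forall t, 0 < t < T -> is_derive t 1 phi (psi t)) ->
  (forall t, 0 < t < T -> is_derive t 1 psi (chi t)) ->
  phi t @[t --> 0^'+] --> phi 0 -> psi t @[t --> 0^'+] --> psi 0 ->
  chi t @[t --> 0^'+] --> chi 0 -> psi 0 = 0 ->
  (forall t, 0 < t < T -> phi 0 <= phi t) -> 0 <= chi 0.
Proof.
move=> T0 dphi dpsi cphi cpsi cchi psi0 hmin; rewrite leNgt; apply/negP => chi0.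
have : \forall t \near 0^'+, chi t < 0 by exact: (cvgr_lt _ cchi).
move=> [e /= e0 he].
pose T' := Num.min e T.
have T'0 : 0 < T' by rewrite lt_min e0.
have T'T : T' <= T by rewrite ge_min lexx orbT.
have sub s : 0 < s < T' -> 0 < s < T.
  by move=> /andP[-> sT]/=; exact: lt_le_trans T'T.
have t0 : 0 < T' / 2 < T' by apply/andP; split; lra.
suff : phi (T' / 2) < phi 0 by rewrite ltNge hmin// sub.
apply: (@lt_of_derive_lt0 _ psi T') => //.
  by move=> t /sub; exact: dphi.
move=> t tT; rewrite -psi0; apply: (@lt_of_derive_lt0 _ chi T') => //.
  by move=> s /sub; exact: dpsi.
move=> s /andP[s1 s2]; apply: he => //=.
rewrite sub0r normrN gtr0_norm//; apply: lt_le_trans s2 _.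
by rewrite ge_min lexx.
Qed.

Variable d : nat.
Implicit Types (x v w : 'rV[R]_d) (Q : set 'rV[R]_d).

Lemma ray_cvg x v : x + t *: v @[t --> 0^'+] --> x.
Proof.
apply: cvg_at_right_filter.
rewrite -[in X in _ --> X](addr0 x) -(scale0r v).
apply: (@cvgD R 'rV[R]_d); first exact: cvg_cst.
exact: (@scalel_continuous R 'rV[R]_d v 0).
Qed.

Lemma ray_cvg_within Q (U : topologicalType) (f : 'rV[R]_d -> U) x v :
  {within Q, continuous f} -> Q x -> (\forall t \near 0^'+, Q (x + t *: v)) ->
  f (x + t *: v) @[t --> 0^'+] --> f x.
Proof.
move=> /subspace_continuousP cf Qx Qt; apply: (cvg_comp _ _ _ (cf _ Qx)).
move=> A /= /(ray_cvg v); rewrite /nbhs /= => hA.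
by near=> t; have := near hA t; apply => //; near: t.
Unshelve. all: by end_near. Qed.

(** The ray only has to enter [Q], with limits of the function and its derivatives at the starting
    point, so interior and boundary points are covered together. *)
Lemma C2_ray_min Q f Df D2f x v :
  C2_on Q f Df D2f -> (\forall t \near 0^'+, Q (x + t *: v)) ->
  f (x + t *: v) @[t --> 0^'+] --> f x ->
  Df (x + t *: v) @[t --> 0^'+] --> Df x ->
  D2f (x + t *: v) @[t --> 0^'+] --> D2f x ->
  (\forall t \near 0^'+, f x <= f (x + t *: v)) ->
  0 <= dotv v (Df x) /\
  (dotv v (Df x) = 0 -> 0 <= dotv v (v *m D2f x)).
Proof.
move=> C2 Qt cf cDf cD2f fmin.
have [T T0 hT] : exists2 T : R, 0 < T & forall t, 0 < t < T ->
    Q (x + t *: v) /\ f x <= f (x + t *: v).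
  have [T /= T0 hT] : \forall t \near 0^'+, Q (x + t *: v) /\ f x <= f (x + t *: v).
    by apply: filterS2 Qt fmin.
  exists T => // t /andP[t0 tT]; apply: hT => //=.
  by rewrite sub0r normrN gtr0_norm.
pose phi t := f (x + t *: v).
pose psi t := dotv v (Df (x + t *: v)).
pose chi t := dotv v (v *m D2f (x + t *: v)).
have x0 : x + 0 *: v = x by rewrite scale0r addr0.
have dphi t : 0 < t < T -> is_derive t 1 phi (psi t).
  move=> /hT[/C2[df Df_ _ _ _] _].
  have := is_derive_line (diff_derivable (v := v) df).
  by rewrite Df_.
have dpsi t : 0 < t < T -> is_derive t 1 psi (chi t).
  move=> /hT[/C2[_ _ df Df_ _] _].
  have [h1 h2] := is_derive_line (diff_derivable (v := v) df).
  have := is_derive_dotv v h1.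
  by rewrite h2 Df_.
have cphi : phi t @[t --> 0^'+] --> phi 0 by rewrite /phi x0.
have cpsi : psi t @[t --> 0^'+] --> psi 0.
  by rewrite /psi x0; apply: cvg_dotv => //; exact: cvg_cst.
have cchi : chi t @[t --> 0^'+] --> chi 0.
  rewrite /chi x0; apply: cvg_dotv; first exact: cvg_cst.
  by apply: cvg_mulmx => //; exact: cvg_cst.
have pmin t : 0 < t < T -> phi 0 <= phi t by rewrite /phi x0 => /hT[].
have psiE : dotv v (Df x) = psi 0 by rewrite /psi x0.
have chiE : dotv v (v *m D2f x) = chi 0 by rewrite /chi x0.
rewrite psiE chiE; split; first exact: (right_min_derive_ge0 T0 dphi).
move=> psi0; exact: (right_min_derive2_ge0 T0 dphi dpsi).
Qed.

Lemma C2_interior_min Q f Df D2f x :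
  open Q -> C2_on Q f Df D2f -> Q x -> (\forall y \near x, f x <= f y) ->
  Df x = 0 /\ forall v, 0 <= dotv v (v *m D2f x).
Proof.
move=> oQ C2 Qx fmin.
have key v : 0 <= dotv v (Df x) /\
    (dotv v (Df x) = 0 -> 0 <= dotv v (v *m D2f x)).
  have [df _ dDf _ cD2f] := C2 x Qx.
  apply: (C2_ray_min C2).
  - by apply: (ray_cvg v); apply: open_nbhs_nbhs.
  - exact: (cvg_comp _ _ (@ray_cvg x v) (differentiable_continuous df)).
  - exact: (cvg_comp _ _ (@ray_cvg x v) (differentiable_continuous dDf)).
  - exact: (cvg_comp _ _ (@ray_cvg x v) cD2f).
  - exact: (@ray_cvg x v [set y | f x <= f y] fmin).
have Dfx v : dotv v (Df x) = 0.
  have [h1 _] := key v; have [] := key (- v); rewrite dotvNl => h2 _; lra.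
split; first by apply: sqnorm_eq0; exact: Dfx.
by move=> v; apply: (key v).2.
Qed.

End DirectionalDerivatives.

(** * Chain rules for C^2 functions and the Rayleigh quotient *)

Lemma cvg_mxZD (R : realType) (T : Type) (F : set_system T) (m n : nat)
    (s t : T -> R) (f g : T -> 'M[R]_(m, n)) (a b : R) (A B : 'M[R]_(m, n)) :
  Filter F -> s @ F --> a -> f @ F --> A -> t @ F --> b -> g @ F --> B ->
  s x *: f x + t x *: g x @[x --> F] --> a *: A + b *: B.
Proof.
move=> FF sa fA tb gB; apply: cvg_mx_entries => i j.
under eq_fun do rewrite !mxE.
rewrite !mxE; apply: cvgD; apply: cvgM => //; exact: cvg_mx_coord.
Qed.

Section SecondOrderCalculus.
Variables (R : realType) (d : nat).
Implicit Types (x v : 'rV[R]_d) (U : set 'rV[R]_d).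

Lemma differentiable_mx_entries (F : 'rV[R]_d -> 'rV[R]_d) x :
  (forall i, differentiable (fun z => F z 0 i) x) -> differentiable F x.
Proof.
move=> h; have -> : F = \sum_(i < d) (fun z => F z 0 i *: delta_mx 0 i).
  by apply/funext => z; rewrite fct_sumE -row_sum_delta.
apply: differentiable_sum => i; exact: differentiableZl.
Qed.

Lemma differentiable_mx_coord (F : 'rV[R]_d -> 'rV[R]_d) x i :
  differentiable F x -> differentiable (fun z => F z 0 i) x.
Proof.
by move=> dF; exact: (differentiable_comp dF (differentiable_coord (F x) 0 i)).
Qed.

Lemma chain_rule1 (f : 'rV[R]_d -> R) (h : R -> R) (h1 : R) x v :
  differentiable f x -> is_derive (f x) 1 h h1 ->
  differentiable (h \o f) x /\ 'D_v (h \o f) x = h1 * 'D_v f x.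
Proof.
move=> df [dh h1E]; have dh' : differentiable h (f x) by exact/derivable1_diffP.
have dc : differentiable (h \o f) x by exact: differentiable_comp.
split=> //; rewrite !deriveE// diff_comp//= deriv1E// derive1E h1E.
by rewrite mulrC.
Qed.

Lemma scale_rule (k : 'rV[R]_d -> R) (F : 'rV[R]_d -> 'rV[R]_d) x v :
  differentiable k x -> differentiable F x ->
  differentiable (fun z => k z *: F z) x /\
  'D_v (fun z => k z *: F z) x = 'D_v k x *: F x + k x *: 'D_v F x.
Proof.
move=> dk dF.
have dkF : differentiable (fun z => k z *: F z) x.
  apply: differentiable_mx_entries => i.
  have -> : (fun z => (k z *: F z) 0 i) = k * (fun z => F z 0 i).
    by apply/funext => z; rewrite mxE.
  by apply: differentiableM => //; exact: differentiable_mx_coord.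
split => //; apply/rowP => i.
have [_ <-] := is_derive_coord 0 i (diff_derivable (v := v) dkF).
have -> : (fun z => (k z *: F z) 0 i) = k * (fun z => F z 0 i).
  by apply/funext => z; rewrite mxE.
have [h1 h2] := is_derive_coord 0 i (diff_derivable (v := v) dF).
rewrite deriveM//; last exact: diff_derivable.
rewrite h2 !mxE addrC; congr (_ + _); exact: mulrC.
Qed.

(** Serves twice: with the logarithm for [ln V], and with an exponential of the squared distance for
    the barrier. *)
Lemma C2_on_comp U f Df D2f (h h1 h2 : R -> R) :
  C2_on U f Df D2f ->
  (forall x, U x -> [/\ is_derive (f x) 1 h (h1 (f x)),
                        is_derive (f x) 1 h1 (h2 (f x))
                      & {for f x, continuous h2}]) ->
  C2_on U (fun x => h (f x)) (fun x => h1 (f x) *: Df x)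
    (fun x => h1 (f x) *: D2f x + h2 (f x) *: ((Df x)^T *m Df x)).
Proof.
move=> C2 hh x Ux; have [df Dfx dDf D2fx cD2f] := C2 x Ux.
have [dh dh1 ch2] := hh x Ux.
have cf : {for x, continuous f} by exact: differentiable_continuous.
have cDf : {for x, continuous Df} by exact: differentiable_continuous.
have dh1f : differentiable (h1 \o f) x by have [] := chain_rule1 0 df dh1.
have ch1f := differentiable_continuous dh1f.
split.
- by have [] := chain_rule1 0 df dh.
- by move=> v; have [_ E] := chain_rule1 v df dh; rewrite -[LHS]/('D_v (h \o f) x) E Dfx dotvZr.
- by have [] := scale_rule 0 dh1f dDf.
- move=> v; have [_ E] := scale_rule v dh1f dDf.
  rewrite -[LHS]/('D_v (fun z => (h1 \o f) z *: Df z) x) E.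
  have [_ ->] := chain_rule1 v df dh1.
  rewrite Dfx D2fx mulmxDr -!scalemxAr addrC; congr (_ + _).
  rewrite -scalerA; congr (_ *: _).
  rewrite mulmxA [v *m _]mx11_scalar mul_scalar_mx; congr (_ *: _).
  by rewrite dotvE.
- have h2f : {for x, continuous (h2 \o f)} by exact: (cvg_comp _ _ cf ch2).
  have out : (Df z)^T *m Df z @[z --> x] --> (Df x)^T *m Df x.
    exact: (cvg_mulmx (cvg_trmx cDf) cDf).
  exact: (cvg_mxZD _ ch1f cD2f h2f out).
Qed.

Lemma C2_on_lin U f Df D2f g Dg D2g (t : R) :
  C2_on U f Df D2f -> C2_on U g Dg D2g ->
  C2_on U (fun x => f x + t * g x) (fun x => Df x + t *: Dg x)
    (fun x => D2f x + t *: D2g x).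
Proof.
move=> C2f C2g x Ux; have [df Dfx dDf D2fx cD2f] := C2f x Ux.
have [dg Dgx dDg D2gx cD2g] := C2g x Ux.
split.
- exact: (differentiableD df (differentiableZ t dg)).
- move=> v; rewrite -[LHS]/('D_v (f + t *: g) x) deriveD; last 2 first.
  + exact: diff_derivable.
  + by apply: derivableZ; exact: diff_derivable.
  rewrite deriveZ; last exact: diff_derivable.
  by rewrite Dfx Dgx dotvDr dotvZr.
- exact: (differentiableD dDf (differentiableZ t dDg)).
- move=> v; rewrite -[LHS]/('D_v (Df + t *: Dg) x) deriveD; last 2 first.
  + exact: diff_derivable.
  + by apply: derivableZ; exact: diff_derivable.
  rewrite deriveZ; last exact: diff_derivable.
  by rewrite D2fx D2gx mulmxDr -scalemxAr.
- have := cvg_mxZD _ (cvg_cst (1 : R)) cD2f (cvg_cst t) cD2g.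
  by under eq_fun do rewrite scale1r; rewrite scale1r; apply.
Qed.

Lemma C2_on_subset U W f Df D2f :
  W `<=` U -> C2_on U f Df D2f -> C2_on W f Df D2f.
Proof. by move=> WU C2 x /WU; exact: C2. Qed.

Lemma C2_on_sqdist U (y : 'rV[R]_d) :
  C2_on U (fun x => sqnorm (x - y)) (fun x => 2 *: (x - y)) (fun=> 2%:M).
Proof.
move=> x _.
have dl : differentiable (fun x : 'rV[R]_d => 2 *: (x - y)) x.
  have -> : (fun x : 'rV[R]_d => 2 *: (x - y)) = 2 *: (id - cst y) by [].
  apply: differentiableZ; apply: differentiableB => //.
split=> //.
- have -> : (fun x => sqnorm (x - y)) =
      \sum_(i < d) ((fun x : 'rV[R]_d => x 0 i) - cst (y 0 i)) ^+ 2.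
    apply/funext => z; rewrite fct_sumE; apply: eq_bigr => i _.
    by rewrite !mxE expr2.
  apply: differentiable_sum => i; apply: differentiableX.
  by apply: differentiableB => //; exact: differentiable_coord.
- move=> v; apply: derive_val; apply: is_derive_cvg.
  rewrite dotvZr.
  have E : {near 0^', (fun h : R => 2 * dotv v (x - y) + h * sqnorm v) =1
      (fun h : R => h^-1 *: (sqnorm (h *: v + x - y) - sqnorm (x - y)))}.
    near=> h; have h0 : h != 0 by near: h; exact: nbhs_dnbhs_neq.
    rewrite -addrA (sqnormD (h *: v)) sqnormZ dotvZl.
    rewrite [RHS](_ : _ = h^-1 * (h ^+ 2 * sqnorm v +
      2 * (h * dotv v (x - y)) + sqnorm (x - y) - sqnorm (x - y)))//.
    by field.
  have L : 2 * dotv v (x - y) + h * sqnorm v @[h --> (0 : R)^'] -->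
      2 * dotv v (x - y) + 0 * sqnorm v.
    apply: cvgD; first exact: cvg_cst.
    apply: cvgM; last exact: cvg_cst.
    exact: cvg_within.
  by rewrite mul0r addr0 in L; exact: cvg_trans (near_eq_cvg E) L.
- move=> v; apply: derive_val; apply: is_derive_cvg.
  have E : {near 0^', (fun h : R => v *m 2%:M) =1
      (fun h : R => h^-1 *: (2 *: (h *: v + x - y) - 2 *: (x - y)))}.
    near=> h; have h0 : h != 0 by near: h; exact: nbhs_dnbhs_neq.
    rewrite mul_mx_scalar -[h *: v + x - y]addrA -scalerBr addrK.
    by rewrite !scalerA mulrAC mulVf// mul1r.
  exact: cvg_trans (near_eq_cvg E) (cvg_cst _).
- exact: (@cst_continuous 'rV[R]_d 'M[R]_d 2%:M x).
Unshelve. all: by end_near. Qed.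

(** The quadratic form attains its minimum [m] over the unit sphere at some [u]. Moving [u] against
    the defect [g = u A - m u] would decrease the form below [m] times the squared norm unless
    [g = 0], so [m] is an eigenvalue. *)
Lemma rayleigh_lower_bound (A : 'M[R]_d) (lam : R) :
  A^T = A -> (forall e, eigenvalue A e -> lam <= e) ->
  forall v, lam * sqnorm v <= dotv (v *m A) v.
Proof.
move=> symA eigA v.
have [->|v0] := eqVneq v 0; first by rewrite mul0mx /sqnorm dotv0l mulr0.
pose q w := dotv (w *m A) w.
have qZ t w : q (t *: w) = t ^+ 2 * q w.
  by rewrite /q -scalemxAl dotvZl dotvZr mulrA.
have cq : continuous q.
  move=> w.
  have c1 : z *m A @[z --> w] --> w *m A.
    exact: (@cvg_mulmx R _ (nbhs w) _ _ _ _ id (fun=> A) w A cvg_id (cvg_cst _)).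
  exact: (@cvg_dotv R _ (nbhs w) _ _ (mulmxr A) id (w *m A) w c1 cvg_id).
pose S := [set w : 'rV[R]_d | sqnorm w = 1].
have normalized w : w != 0 -> S ((Num.sqrt (sqnorm w))^-1 *: w).
  move=> w0; rewrite /S /= sqnormZ exprVn sqr_sqrtr ?sqnorm_ge0//.
  by rewrite mulVf// gt_eqF// sqnorm_gt0.
have cS : compact S.
  apply: bounded_closed_compact.
    exists 1; split; first exact: num_real.
    move=> r r1 w /= w1; have := normr_sqnorm w; rewrite w1 => h.
    apply: le_trans (ltW r1); rewrite -(@ler_pXn2r _ 2) ?nnegrE ?expr1n//.
  have := (@sqnorm_continuous R d 0); rewrite (_ : (fun x => _) = @sqnorm R d).
    by move=> /continuous_closedP/(_ [set 1] (@closed_eq _ 1)).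
  by apply/funext => w; rewrite subr0.
have [u Su umin] := compact_EVT_min (ex_intro S _ (normalized _ v0)) cS
  (continuous_subspaceT cq).
pose m := q u.
have mq w : m * sqnorm w <= q w.
  have [->|w0] := eqVneq w 0; first by rewrite /q /sqnorm mul0mx dotv0l mulr0.
  have := umin _ (mem_set (normalized _ w0)).
  rewrite qZ exprVn sqr_sqrtr ?sqnorm_ge0// mulrC ler_pdivlMr//.
  exact: sqnorm_gt0.
have [g gE] : exists g, g = u *m A - m *: u by eexists.
have g0 : g = 0.
  apply: sqnorm_eq0; apply/eqP; rewrite eq_le sqnorm_ge0 andbT leNgt.
  apply/negP => s0; set s := sqnorm g in s0.
  pose B := q g - m * s.
  have B0 : 0 <= B by rewrite subr_ge0 mq.
  have key t : 0 <= - 2 * t * s + t ^+ 2 * B.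
    have := mq (u - t *: g).
    have -> : q (u - t *: g) = m - 2 * t * dotv (u *m A) g + t ^+ 2 * q g.
      rewrite /q mulmxBl dotvDl !dotvDr !dotvNl !dotvNr -scalemxAl !dotvZl !dotvZr.
      have -> : dotv (g *m A) u = dotv (u *m A) g.
        by rewrite dotv_mulmxl symA dotvC.
      rewrite -/(q g) -[dotv (u *m A) u]/m; ring.
    have -> : sqnorm (u - t *: g) = 1 - 2 * t * dotv u g + t ^+ 2 * s.
      rewrite sqnormD sqnormN sqnormZ dotvNr dotvZr -/s.
      have -> : sqnorm u = 1 := set_mem Su.
      ring.
    have E : s = dotv (u *m A) g - m * dotv u g.
      by rewrite /s {1}/sqnorm {1}gE dotvDl dotvNl dotvZl.
    rewrite /B [in - 2 * t * s]E; lra.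
  (* A step at which the quadratic in [t] is negative; [B + 1] avoids dividing by a vanishing
     [B]. *)
  have := key (s / (B + 1)).
  have B1 : 0 < B + 1 by rewrite ltr_wpDl.
  have B1n : B + 1 != 0 by rewrite gt_eqF.
  have -> : - 2 * (s / (B + 1)) * s + (s / (B + 1)) ^+ 2 * B =
     - (s ^+ 2 / (B + 1) ^+ 2) * (B + 2) by field.
  rewrite mulNr oppr_ge0 leNgt; apply/negP; rewrite negbK.
  by rewrite mulr_gt0 ?divr_gt0 ?exprn_gt0// ltr_wpDl.
have um : eigenvalue A m.
  apply/eigenvalueP; exists u; first by apply/eqP; rewrite -subr_eq0 -gE g0.
  apply: contraTneq Su => ->; apply/negP => /set_mem.
  by rewrite /S /= /sqnorm dotv0l => /esym/eqP; rewrite oner_eq0.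
apply: le_trans (mq v); rewrite ler_wpM2r ?sqnorm_ge0//; exact: eigA.
Qed.

End SecondOrderCalculus.

(** * Geometry of the boundary *)

Section DomainBoundary.
Variables (R : realType) (d : nat).
Implicit Types (p x y v w : 'rV[R]_d) (Q : set 'rV[R]_d).

Lemma quad_le v (A : 'M[R]_d) :
  `|dotv v (v *m A)| <= d%:R * (d%:R * (`|v| ^+ 2 * `|A|)).
Proof.
have sum_le (f : 'I_d -> R) (c : R) : (forall i, `|f i| <= c) ->
    `|\sum_i f i| <= d%:R * c.
  move=> h; apply: le_trans (ler_norm_sum _ _ _) _.
  apply: le_trans (_ : \sum_(i < d) c <= _); first by apply: ler_sum.
  by rewrite sumr_const card_ord mulr_natl.
apply: (sum_le) => i; rewrite mxE big_distrr/=; apply: (sum_le) => j.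
rewrite mulrA !normrM; apply: ler_pM => //; last exact: normr_coord.
by rewrite expr2; apply: ler_pM => //; exact: normr_coord.
Qed.

Lemma sqnormD_le x y : sqnorm (x + y) <= 2 * sqnorm x + 2 * sqnorm y.
Proof.
have := sqnorm_ge0 (x - y); rewrite !sqnormD sqnormN dotvNr; lra.
Qed.

(** Second-order Taylor bound from two mean value arguments, the Hessian being bounded near [p] by
    continuity. An upper bound is what places points in the sublevel set [psi < 0]. *)
Lemma C2_on_quadratic_upper_bound (U : set 'rV[R]_d) psi Dpsi D2psi p :
  open U -> U p -> C2_on U psi Dpsi D2psi ->
  exists2 e : R, 0 < e & exists2 M : R, 0 <= M & forall w, `|w| < e ->
    U (p + w) /\ psi (p + w) <= psi p + dotv w (Dpsi p) + M * `|w| ^+ 2.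
Proof.
move=> oU Up C2; have [_ _ _ _ cD2] := C2 p Up.
pose N := `|D2psi p| + 1.
have : \forall x \near p, U x /\ `|D2psi x| <= N.
  apply: filterI; first by apply: open_nbhs_nbhs.
  have : \forall x \near p, `|D2psi p - D2psi x| < 1.
    by have /cvgrPdist_lt := cD2; apply.
  apply: filterS => x h; rewrite -[D2psi x](subKr (D2psi p)).
  by apply: le_trans (ler_normB _ _) _; rewrite lerD2l ltW.
move=> /nbhs_normP[e /= e0 he].
exists e => //; exists (d%:R * (d%:R * N)); first by rewrite !mulr_ge0// addr_ge0.
move=> w we.
have inU (t : R) : 0 <= t <= 1 -> U (p + t *: w) /\ `|D2psi (p + t *: w)| <= N.
  move=> /andP[t0 t1]; apply: he => /=; rewrite opprD addrA subrr sub0r normrN.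
  rewrite normrZ ger0_norm//; apply: le_lt_trans we.
  by rewrite ler_piMl.
have dphi (t : R) : 0 <= t <= 1 ->
    is_derive t 1 (fun s => psi (p + s *: w)) (dotv w (Dpsi (p + t *: w))).
  move=> /inU[/C2[df Df _ _ _] _].
  by have := is_derive_line (diff_derivable (v := w) df); rewrite Df.
have dpsi (t : R) : 0 <= t <= 1 ->
    is_derive t 1 (fun s => dotv w (Dpsi (p + s *: w)))
      (dotv w (w *m D2psi (p + t *: w))).
  move=> /inU[/C2[_ _ df Df _] _].
  have [h1 h2] := is_derive_line (diff_derivable (v := w) df).
  by have := is_derive_dotv w h1; rewrite h2 Df.
have oo_cc (a b t : R) : 0 <= a -> b <= 1 -> t \in `]a, b[ -> 0 <= t <= 1.
  by move=> a0 b1; rewrite in_itv/= => /andP[h1 h2]; apply/andP; split; lra.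
have cc_cc (a b t : R) : 0 <= a -> b <= 1 -> t \in `[a, b] -> 0 <= t <= 1.
  by move=> a0 b1; rewrite in_itv/= => /andP[h1 h2]; apply/andP; split; lra.
have [||c c01 Ec] := @MVT_segment R (fun s => psi (p + s *: w))
    (fun t => dotv w (Dpsi (p + t *: w))) 0 1 ler01.
- by move=> t /oo_cc-/(_ (lexx _) (lexx _)); exact: dphi.
- apply: derivable_within_continuous => t /cc_cc-/(_ (lexx _) (lexx _)).
  by move=> /dphi[].
have c01' := cc_cc _ _ _ (lexx _) (lexx _) c01.
have /andP[c0 c1] := c01'.
have [||c' c0' Ec'] := @MVT_segment R (fun s => dotv w (Dpsi (p + s *: w)))
    (fun t => dotv w (w *m D2psi (p + t *: w))) 0 c c0.
- by move=> t /oo_cc-/(_ (lexx _) c1); exact: dpsi.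
- apply: derivable_within_continuous => t /cc_cc-/(_ (lexx _) c1).
  by move=> /dpsi[].
have [Upw _] := inU 1 (introT andP (conj ler01 (lexx _))).
move: Ec Ec' Upw; rewrite !scale1r !scale0r !addr0 !subr0 mulr1 => Ec Ec' Upw.
split=> //.
have [_ D2le] := inU c' (cc_cc _ _ _ (lexx _) c1 c0').
have q1 := quad_le w (D2psi (p + c' *: w)).
have q2 : d%:R * (d%:R * (`|w| ^+ 2 * `|D2psi (p + c' *: w)|)) <=
    d%:R * (d%:R * N) * `|w| ^+ 2.
  have h : `|w| ^+ 2 * `|D2psi (p + c' *: w)| <= N * `|w| ^+ 2.
    by rewrite mulrC; apply: ler_wpM2r => //; exact: exprn_ge0.
  rewrite -mulrA -(mulrA d%:R N).
  by apply: ler_wpM2l; rewrite ?ler0n//; apply: ler_wpM2l; rewrite ?ler0n.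
have q3 : dotv w (w *m D2psi (p + c' *: w)) * c <= d%:R * (d%:R * N) * `|w| ^+ 2.
  apply: le_trans (ler_norm _) _; rewrite normrM (ger0_norm c0).
  apply: le_trans (_ : `|dotv w (w *m D2psi (p + c' *: w))| <= _).
    by rewrite ler_piMr.
  exact: le_trans q1 q2.
lra.
Qed.

(** At [p] the defining function vanishes, so near [p] it is at most [k <w, n> + M |w|^2]. This is
    negative along every strictly inward ray close to [p], and in a small enough ball tangent at
    [p]. *)
Lemma boundary_point_geometry Q n p :
  C2_boundary_normal Q n -> bdry Q p ->
  [/\ sqnorm (n p) = 1,
      (forall v, dotv v (n p) < 0 -> \forall t \near 0^'+, Q (p + t *: v))
    & exists y s, [/\ 0 < s, sqnorm (p - y) = s
        & forall x, sqnorm (x - y) < s -> Q x]].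
Proof.
move=> /(_ p)h bp.
have [U [psi [Dpsi [D2psi [[oU Up C2 Dn0 QU] nE]]]]] := h bp.
have [clQp nQp] := bp.
have [dpsi Dpsip _ _ _] := C2 p Up.
have cpsi := differentiable_continuous dpsi.
have QP x : U x -> psi x < 0 -> Q x.
  move=> Ux px; have : (U `&` [set x | psi x < 0]) x by [].
  by rewrite -QU => -[].
have psip : psi p = 0.
  apply/eqP; rewrite eq_le; apply/andP; split; last first.
    by rewrite leNgt; apply/negP => /(QP _ Up).
  rewrite leNgt; apply/negP => pp.
  have : \forall x \near p, U x /\ 0 < psi x.
    apply: filterI; first exact: open_nbhs_nbhs.
    exact: (cvgr_gt _ cpsi).
  move=> /clQp[x [Qx [Ux px]]].
  have : (Q `&` U) x by [].
  by rewrite QU => -[_ /= ]; rewrite ltNge ltW.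
have Dp0 := Dn0 p Up.
pose k := enorm (Dpsi p).
have k0 : 0 < k by rewrite sqrtr_gt0 sqnorm_gt0.
have k2 : k ^+ 2 = sqnorm (Dpsi p) by rewrite sqr_sqrtr// sqnorm_ge0.
have DE : Dpsi p = k *: n p.
  by rewrite nE -/k scalerA mulfV ?scale1r// gt_eqF.
have n1 : sqnorm (n p) = 1.
  by rewrite nE -/k sqnormZ exprVn k2 mulVf// gt_eqF// sqnorm_gt0.
have [e e0 [M M0 up]] := C2_on_quadratic_upper_bound oU Up C2.
split=> //.
- move=> v vn.
  have [N N0 hN] : exists2 N : R, 0 < N & `|v| <= N.
    by exists (`|v| + 1); [rewrite ltr_wpDl|rewrite lerDl].
  (* The first bound keeps [t *: v] in the neighbourhood of the Taylor estimate, the second makes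
     the linear term beat the quadratic one. *)
  pose T := Num.min (e / N) (k * - dotv v (n p) / (M + 1) / N ^+ 2).
  have M1 : 0 < M + 1 by rewrite ltr_wpDl.
  have T0 : 0 < T.
    by rewrite lt_min divr_gt0//= divr_gt0 ?exprn_gt0// divr_gt0// mulr_gt0// oppr_gt0.
  exists T => // t /= ; rewrite sub0r normrN => tT t0.
  rewrite (gtr0_norm t0) in tT.
  have [tT1 tT2] : t < e / N /\ t < k * - dotv v (n p) / (M + 1) / N ^+ 2.
    by move: tT; rewrite lt_min => /andP[].
  have tv : `|t *: v| <= t * N by rewrite normrZ (gtr0_norm t0) ler_pM2l.
  have [|Utv] := up (t *: v).
    by apply: le_lt_trans tv _; rewrite -ltr_pdivlMr.
  rewrite psip add0r DE dotvZl dotvZr => le.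
  apply: QP => //; apply: le_lt_trans le _.
  have tv2 : `|t *: v| ^+ 2 <= t ^+ 2 * N ^+ 2.
    by rewrite -exprMn lerXn2r ?nnegrE// mulr_ge0 ?(ltW t0) ?(ltW N0).
  have h1 : M * `|t *: v| ^+ 2 <= (M + 1) * (t ^+ 2 * N ^+ 2).
    by apply: ler_pM; rewrite ?exprn_ge0// lerDl.
  have h2 : (M + 1) * (t * N ^+ 2) < k * - dotv v (n p).
    have N2 : 0 < N ^+ 2 by rewrite exprn_gt0.
    by move: tT2; rewrite ltr_pdivlMr// ltr_pdivlMr// mulrC.
  have h3 : t * ((M + 1) * (t * N ^+ 2)) < t * (k * - dotv v (n p)).
    by rewrite ltr_pM2l.
  move: h1 h3; set P := M * _; set D := dotv v _; lra.
(* [e / 4] keeps the ball inside the neighbourhood, since [|w| < 2 r] there. In the ball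
   [2 r <w, n> < - |w|^2], so the second bound makes [k <w, n>] smaller than [- (M + 1) |w|^2]. *)
- pose r := Num.min (e / 4) (k / (2 * (M + 1))).
  have M1 : 0 < M + 1 by rewrite ltr_wpDl.
  have r0 : 0 < r by rewrite lt_min !divr_gt0// mulr_gt0.
  have re : r <= e / 4 by rewrite ge_min lexx.
  have rk : r <= k / (2 * (M + 1)) by rewrite ge_min lexx orbT.
  exists (p - r *: n p), (r ^+ 2); split; first by rewrite exprn_gt0.
    by rewrite opprB addrC subrK sqnormZ n1 mulr1.
  move=> x; rewrite opprB addrA addrAC => hx.
  pose w := x - p; rewrite -/w in hx.
  have -> : x = p + w by rewrite /w addrC subrK.
  have w4 : sqnorm w < 4 * r ^+ 2.
    have := sqnormD_le (w + r *: n p) (- (r *: n p)).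
    rewrite addrK sqnormN sqnormZ n1; lra.
  have we : `|w| < e.
    rewrite -(@ltr_pXn2r _ 2)// ?nnegrE ?(ltW e0)//.
    apply: le_lt_trans (normr_sqnorm w) _; apply: lt_le_trans w4 _.
    have : r ^+ 2 <= (e / 4) ^+ 2 by rewrite lerXn2r// nnegrE ltW// divr_gt0.
    have : 0 <= e ^+ 2 by rewrite sqr_ge0.
    lra.
  have [Upw] := up w we; rewrite psip add0r DE dotvZr => le.
  apply: QP => //; apply: le_lt_trans le _.
  rewrite sqnormD dotvZr sqnormZ n1 in hx.
  have wn : sqnorm w + 2 * (r * dotv w (n p)) < 0 by lra.
  have h1 : M * `|w| ^+ 2 <= M * sqnorm w by rewrite ler_wpM2l// normr_sqnorm.
  have h2 : 2 * (M + 1) * r <= k.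
    by move: rk; rewrite ler_pdivlMr ?mulr_gt0// mulrC.
  have h3 : k * (sqnorm w + 2 * (r * dotv w (n p))) < 0 by rewrite pmulr_rlt0.
  have h4 : 2 * (M + 1) * r * sqnorm w <= k * sqnorm w.
    by rewrite ler_wpM2r// sqnorm_ge0.
  have h5 : 0 <= r * sqnorm w by rewrite mulr_ge0 ?sqnorm_ge0// ltW.
  have h6 : 2 * r * (k * dotv w (n p) + M * sqnorm w) < 0.
    move: h3 h4 h5; set s := sqnorm w; set D := dotv w _; nra.
  have h7 : k * dotv w (n p) + M * sqnorm w < 0.
    by move: h6; rewrite pmulr_rlt0// mulr_gt0.
  lra.
Qed.

(** On the boundary, [- gam] points strictly inward by ellipticity, and so does [- gam] plus a small
    multiple of any [w]. Derivatives in inward directions are nonnegative and the one along [gam] is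
    0, so the derivative along every [w] is nonnegative and the gradient vanishes. The Hessian is
    then nonnegative in inward directions, in outward ones by evenness, and in tangential ones by a
    small perturbation. *)
Lemma C2gamma_min Q n sigma (g : C2fun R d) x :
  open Q -> C2_boundary_normal Q n -> C2gamma Q sigma n g ->
  (forall y, closure Q y -> forall v, v != 0 -> 0 < dotv (v *m amat sigma y) v) ->
  closure Q x -> (forall y, closure Q y -> g.1.1 x <= g.1.1 y) ->
  g.1.2 x = 0 /\ forall v, 0 <= dotv v (v *m g.2 x).
Proof.
move=> oQ bQ [[C2 cf cDf cD2f] gb] apos clx gmin.
have key v : (\forall t \near 0^'+, Q (x + t *: v)) ->
    0 <= dotv v (g.1.2 x) /\
    (dotv v (g.1.2 x) = 0 -> 0 <= dotv v (v *m g.2 x)).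
  move=> Qt.
  have clt : \forall t \near 0^'+, closure Q (x + t *: v).
    by apply: filterS Qt => t; exact: subset_closure.
  apply: (C2_ray_min C2 Qt).
  - exact: ray_cvg_within cf clx clt.
  - exact: ray_cvg_within cDf clx clt.
  - exact: ray_cvg_within cD2f clx clt.
  - by apply: filterS clt => t; exact: gmin.
have [Qx|nQx] := pselect (Q x).
  apply: (C2_interior_min oQ C2 Qx).
  have : nbhs x Q by exact: open_nbhs_nbhs.
  by apply: filterS => y Qy; apply: gmin; exact: subset_closure.
have bx : bdry Q x by [].
have [n1 inward _] := boundary_point_geometry bQ bx.
have n0 : n x != 0.
  by apply: contra_eq_neq n1 => ->; rewrite /sqnorm dotv0l eq_sym oner_eq0.
pose gam := conormal sigma n x.
have gam0 : dotv (g.1.2 x) gam = 0 by exact: gb.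
have gamn : 0 < dotv gam (n x).
  by rewrite /gam /conormal amat_sym; exact: apos.
have Dge0 w : 0 <= dotv w (g.1.2 x).
  (* Small enough for [eps *: w] to use up less than half of the inward component of [- gam]. *)
  pose eps := dotv gam (n x) / (2 * (`|dotv w (n x)| + 1)).
  have W1 : 0 < `|dotv w (n x)| + 1 by rewrite ltr_wpDl.
  have eps0 : 0 < eps by rewrite divr_gt0// mulr_gt0.
  have vn : dotv (- gam + eps *: w) (n x) < 0.
    rewrite dotvDl dotvNl dotvZl.
    have h1 : eps * dotv w (n x) <= eps * `|dotv w (n x)|.
      by rewrite ler_pM2l// ler_norm.
    have h2 : eps * (2 * (`|dotv w (n x)| + 1)) = dotv gam (n x).
      by rewrite divfK// gt_eqF// mulr_gt0.
    nra.
  have [h _] := key _ (inward _ vn).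
  move: h; rewrite dotvDl dotvNl (dotvC gam) gam0 oppr0 add0r dotvZl.
  by rewrite pmulr_rge0.
have D0 : g.1.2 x = 0.
  apply: sqnorm_eq0; apply/eqP; rewrite eq_le sqnorm_ge0 andbT.
  by have := Dge0 (- g.1.2 x); rewrite dotvNl oppr_ge0.
split=> //.
have neg v : dotv v (n x) < 0 -> 0 <= dotv v (v *m g.2 x).
  by move=> vn; apply: (key _ (inward _ vn)).2; rewrite D0 dotv0r.
move=> v; have [vn|vn|vn] := ltgtP (dotv v (n x)) 0.
- exact: neg.
- have : dotv (- v) (n x) < 0 by rewrite dotvNl oppr_lt0.
  by move=> /neg; rewrite mulNmx dotvNl dotvNr opprK.
- rewrite leNgt; apply/negP => qv.
  set A := g.2 x in qv neg *.
  pose k := - dotv v (v *m A).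
  pose B := dotv v (n x *m A) + dotv (n x) (v *m A).
  pose C := dotv (n x) (n x *m A).
  have k0 : 0 < k by rewrite oppr_gt0.
  (* Tilting the tangential [v] inward by [s] changes the form by [- s B + s^2 C], which is less
     than [k] because [s <= 1] and [s (|B| + |C|) < k]; the value [- k] thus stays negative. *)
  pose s := k / (`|B| + `|C| + k).
  have S0 : 0 < `|B| + `|C| + k by rewrite ltr_wpDl// addr_ge0.
  have s0 : 0 < s by rewrite divr_gt0.
  have s1 : s <= 1.
    by rewrite ler_pdivrMr// mul1r lerDr addr_ge0.
  have : dotv (v - s *: n x) (n x) < 0.
    rewrite dotvDl dotvNl dotvZl vn -/(sqnorm (n x)) n1 mulr1 add0r.
    by rewrite oppr_lt0.
  move=> /neg.
  have -> : dotv (v - s *: n x) ((v - s *: n x) *m A) = - k - s * B + s ^+ 2 * C.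
    rewrite mulmxBl !dotvDl !dotvDr !dotvNl !dotvNr -!scalemxAl !dotvZl !dotvZr.
    rewrite /k /B /C opprK; ring.
  have h1 : - (s * B) <= s * `|B|.
    by rewrite -mulrN ler_pM2l// ler_normr lexx orbT.
  have h2 : s ^+ 2 * C <= s * `|C|.
    apply: le_trans (_ : s ^+ 2 * `|C| <= _).
      by rewrite ler_pM2l ?exprn_gt0// ler_norm.
    by rewrite ler_wpM2r// expr2 ler_piMr// ltW.
  have h3 : s * (`|B| + `|C| + k) = k by rewrite divfK// gt_eqF.
  have h4 : 0 < s * k by rewrite mulr_gt0.
  move=> h5.
  have : s * (`|B| + `|C|) < k by move: h3 h4; rewrite mulrDr; lra.
  rewrite mulrDr; lra.
Qed.

End DomainBoundary.

(** * Hopf's lemma and the strong maximum principle *)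

Section StrongMaximumPrinciple.
Variables (R : realType) (d : nat).
Implicit Types (p x y v w : 'rV[R]_d) (Q : set 'rV[R]_d).

(** Hopf's barrier without the constant that makes it vanish on the outer sphere; that constant
    enters the comparison as [E0]. *)
Definition barrier (al : R) y x : R := expR (- al * sqnorm (x - y)).

Definition Dbarrier (al : R) y x : 'rV[R]_d :=
  (- al * barrier al y x) *: (2 *: (x - y)).

Definition D2barrier (al : R) y x : 'M[R]_d :=
  (- al * barrier al y x) *: 2%:M +
  (al ^+ 2 * barrier al y x) *: ((2 *: (x - y))^T *m (2 *: (x - y))).

Lemma C2_on_barrier U al y :
  C2_on U (barrier al y) (Dbarrier al y) (D2barrier al y).
Proof.
have dexp (t : R) : is_derive t 1 (fun s => expR (- al * s)) (- al * expR (- al * t)).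
  have -> : (fun s => expR (- al * s)) = expR \o (fun s => - al * s) by [].
  have h : is_derive t (1 : R) (fun s : R => - al * s) (- al).
    have -> : (fun s : R => - al * s) = (- al) *: id by [].
    by apply: is_derive_eq; rewrite [_ *: _]mulr1.
  have h' := is_derive1_comp (is_derive_expR (- al * t)) h.
  by apply: is_derive_eq h' _; rewrite mulrC.
have := @C2_on_comp R d U (fun x => sqnorm (x - y)) (fun x => 2 *: (x - y))
  (fun=> 2%:M) (fun s => expR (- al * s)) (fun s => - al * expR (- al * s))
  (fun s => al ^+ 2 * expR (- al * s)) (C2_on_sqdist y).
apply => x _; split => //.
- have -> : (fun s => - al * expR (- al * s)) =
    (- al) *: (fun s => expR (- al * s)) by [].
  have := @is_deriveZ _ _ _ (fun s => expR (- al * s)) (- al) _ 1 _ (dexp (sqnorm (x - y))).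
  by move=> h; apply: is_derive_eq h _; rewrite [_ *: _]mulrA mulrNN.
- have [h _] := dexp (sqnorm (x - y)).
  apply: cvgM; first exact: cvg_cst.
  have /differentiable_continuous := (derivable1_diffP _ _).1 h; exact.
Qed.

Lemma mxtrace_D2barrier (A : 'M[R]_d) al y x :
  2^-1 * \tr (A *m D2barrier al y x) =
  barrier al y x * (2 * al ^+ 2 * dotv ((x - y) *m A) (x - y) - al * \tr A).
Proof.
rewrite /D2barrier; have [u uE] : exists u, u = 2 *: (x - y) by eexists.
rewrite -uE mulmxDr -!scalemxAr mxtraceD !mxtraceZ mxtrace_outer.
rewrite mul_mx_scalar mxtraceZ uE -scalemxAl dotvZl dotvZr {uE u}.
by field.
Qed.

Lemma closed_sqball y (s : R) : closed [set x : 'rV[R]_d | sqnorm (x - y) <= s].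
Proof.
have /continuous_closedP := @sqnorm_continuous R d y.
exact: (fun h => h _ (@closed_le R s)).
Qed.

Lemma closed_sqball_ge y (s : R) : closed [set x : 'rV[R]_d | s <= sqnorm (x - y)].
Proof.
have /continuous_closedP := @sqnorm_continuous R d y.
exact: (fun h => h _ (@closed_ge R s)).
Qed.

Lemma compact_sqball y (s : R) : compact [set x : 'rV[R]_d | sqnorm (x - y) <= s].
Proof.
apply: bounded_closed_compact; last exact: closed_sqball.
exists (`|y| + 1 + s); split; first exact: num_real.
move=> r hr x /= xs; apply: le_trans (ltW hr).
rewrite -[x](subrK y) addrC; apply: le_trans (ler_normD _ _) _.
rewrite -addrA lerD2l.
have h1 := le_trans (normr_sqnorm (x - y)) xs.
(* From [2 r <= 1 + r^2], a bound on the norm by [1 + s] without a square root. *)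
have := sqr_ge0 (`|x - y| - 1); nra.
Qed.

Lemma open_sqball y (s : R) : open [set x : 'rV[R]_d | sqnorm (x - y) < s].
Proof.
have /continuousP := @sqnorm_continuous R d y.
exact: (fun h => h _ (@open_lt R s)).
Qed.

Lemma open_sqball_gt y (s : R) : open [set x : 'rV[R]_d | s < sqnorm (x - y)].
Proof.
have /continuousP := @sqnorm_continuous R d y.
exact: (fun h => h _ (@open_gt R s)).
Qed.

Lemma nbhs_sqball x (U : set 'rV[R]_d) : open U -> U x ->
  exists2 s : R, 0 < s & forall y, sqnorm (y - x) < s -> U y.
Proof.
move=> oU Ux; have : nbhs x U by exact: open_nbhs_nbhs.
move=> /nbhs_normP[e /= e0 he].
exists (e ^+ 2); first by rewrite exprn_gt0.
move=> y yx; apply: he => /=; rewrite distrC.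
rewrite -(@ltr_pXn2r _ 2)// ?nnegrE ?(ltW e0)//.
exact: le_lt_trans (normr_sqnorm _) yx.
Qed.

Lemma sqball_closure x y (s : R) : 0 < s -> sqnorm (x - y) <= s ->
  closure [set z : 'rV[R]_d | sqnorm (z - y) < s] x.
Proof.
move=> s0 xs B nB.
have /(_ B nB) := @ray_cvg R d x (y - x); rewrite /nbhs/= => -[e /= e0 he].
pose t := Num.min (e / 2) (1 / 2).
have t0 : 0 < t by rewrite lt_min !divr_gt0.
have te : t < e by apply: le_lt_trans (_ : e / 2 < _); [rewrite ge_min lexx|lra].
have t1 : t <= 1 / 2 by rewrite ge_min lexx orbT.
exists (x + t *: (y - x)); split; last first.
  by apply: he => //=; rewrite sub0r normrN gtr0_norm.
rewrite /=.
have -> : x + t *: (y - x) - y = (1 - t) *: (x - y).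
  by rewrite scalerBl scale1r -scalerN opprB addrAC.
rewrite sqnormZ; apply: le_lt_trans (_ : (1 - t) ^+ 2 * s < _).
  by rewrite ler_wpM2l// sqr_ge0.
rewrite gtr_pMl// expr2; nra.
Qed.

(** * Supersolutions of a linear elliptic operator with zeroth-order term [- k] *)

Section Hopf.
Variables (Q : set 'rV[R]_d) (a : 'rV[R]_d -> 'M[R]_d) (be : 'rV[R]_d -> 'rV[R]_d).
Variables (sg : 'rV[R]_d -> 'M[R]_d) (V : C2fun R d) (lam A0 B k : R).
Hypothesis oQ : open Q.
Hypothesis aE : forall x, a x = sg x *m (sg x)^T.
Hypothesis lam0 : 0 < lam.
Hypothesis a_lam : forall x, Q x -> forall v, lam * sqnorm v <= dotv (v *m a x) v.
Hypothesis a_tr : forall x, Q x -> \tr (a x) <= A0.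
Hypothesis be_B : forall x, Q x -> `|be x| <= B.
Hypothesis A0_ge0 : 0 <= A0.
Hypothesis B_ge0 : 0 <= B.
Hypothesis k_ge0 : 0 <= k.
Hypothesis C2V : C2_closure Q V.1.1 V.1.2 V.2.
Hypothesis V_ge0 : forall x, closure Q x -> 0 <= V.1.1 x.
Hypothesis LV_le0 : forall x, Q x ->
  2^-1 * \tr (a x *m V.2 x) + dotv (be x) (V.1.2 x) - k * V.1.1 x <= 0.

(* The exponent al is so large that the barrier is a strict subsolution on the
   annulus s/4 < |x - y|^2 < s. *)
Lemma barrier_subsolution y (s : R) : 0 < s ->
  exists2 al : R, 0 < al & forall x, Q x -> s / 4 <= sqnorm (x - y) <= s ->
    k * barrier al y x <
    2^-1 * \tr (a x *m D2barrier al y x) + dotv (be x) (Dbarrier al y x).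
Proof.
move=> s0.
(* [C1] bounds the trace of [a] plus twice the drift term on the annulus; [ls] bounds twice the
   quadratic form of [a] at [x - y] from below, by ellipticity and [s / 4 <= sqnorm (x - y)]. *)
pose C1 := A0 + 2 * (d%:R * (B * (1 + s))).
have C10 : 0 <= C1.
  by rewrite addr_ge0// !mulr_ge0// addr_ge0// ltW.
pose ls := lam * s / 2.
have ls0 : 0 < ls by rewrite divr_gt0// mulr_gt0.
(* Chosen so that [al * ls = ls + C1 + k]; as [al >= 1], the leading term [al^2 * ls] exceeds
   [al * C1 + k]. *)
pose al := 1 + (C1 + k) / ls.
have al1 : 1 <= al by rewrite lerDl; apply: divr_ge0; [exact: addr_ge0|exact: ltW].
have al0 : 0 < al by exact: lt_le_trans al1.
exists al => // x Qx /andP[xs1 xs2].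
have w0 : 0 < barrier al y x by exact: expR_gt0.
rewrite mxtrace_D2barrier /Dbarrier !dotvZr.
set W := barrier al y x in w0 *.
suff h : k < 2 * al ^+ 2 * dotv ((x - y) *m a x) (x - y) - al * \tr (a x) -
    2 * al * dotv (be x) (x - y).
  have {h} := h; rewrite -(ltr_pM2l w0) => h.
  rewrite [ltLHS]mulrC; apply: (lt_le_trans h).
  move: (dotv _ _) (dotv _ _) (\tr _) => r1 r2 r3; lra.
have q1 : lam * s / 4 <= dotv ((x - y) *m a x) (x - y).
  apply: le_trans (a_lam Qx (x - y)); rewrite -mulrA ler_pM2l//.
have q2 := a_tr Qx.
have q3 : dotv (be x) (x - y) <= d%:R * (B * (1 + s)).
  apply: le_trans (ler_norm _) _; apply: le_trans (dotv_le _ _) _.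
  apply: ler_wpM2l => //; apply: ler_pM => //; first exact: be_B.
  have h1 := le_trans (normr_sqnorm (x - y)) xs2.
  have := sqr_ge0 (`|x - y| - 1); nra.
have alE : al * ls = ls + C1 + k.
  by rewrite /al mulrDl mul1r divfK ?gt_eqF// addrA.
set X := dotv _ _ in q1 *; set Y := dotv _ _ in q3 *; set Z := \tr _ in q2 *.
have h1 : al * ls <= 2 * al * X.
  have : ls <= 2 * X by rewrite /ls; lra.
  by rewrite -(ler_pM2l al0) => h; apply: le_trans h _; lra.
have h2 : al * (al * ls) <= 2 * al ^+ 2 * X.
  have := h1; rewrite -(ler_pM2l al0) => h; apply: le_trans h _.
  by rewrite le_eqVlt; apply/orP; left; apply/eqP; ring.
have h3 : al * (Z + 2 * Y) <= al * C1.
  by rewrite ler_pM2l// /C1; lra.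
have h4 : al * (ls + C1 + k) = al * ls + al * C1 + al * k by ring.
have h5 : k <= al * k by rewrite ler_peMl.
have h6 : 0 < al * ls by rewrite mulr_gt0.
rewrite alE h4 in h2.
have h7 : al * (Z + 2 * Y) = al * Z + 2 * al * Y by ring.
rewrite h7 in h3; lra.
Qed.

(** On the annulus [V >= mu (barrier - E0)]: on the inner sphere since [mu] is the minimum of [V]
    over the inner ball, on the outer one since the right side vanishes, in between by comparison.
    Equality at [x0] then forces [V] to grow linearly along the inward radius. *)
Lemma hopf_lemma y (s : R) x0 :
  0 < s -> (forall x, sqnorm (x - y) < s -> Q x /\ 0 < V.1.1 x) ->
  closure Q x0 -> sqnorm (x0 - y) = s -> V.1.1 x0 = 0 -> V.1.2 x0 <> 0.
Proof.
move=> s0 ballQ clx0 x0s V0 DV0.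
have [C2 cV cDV cD2V] := C2V.
have [al al0 sub] := barrier_subsolution y s0.
have clball x : sqnorm (x - y) <= s -> closure Q x.
  move=> xs; have := sqball_closure s0 xs.
  by apply: closureS => z /ballQ[].
have cVball (K : set 'rV[R]_d) : (forall x, K x -> sqnorm (x - y) <= s) ->
    {within K, continuous V.1.1}.
  by move=> h; apply: (continuous_subspaceW _ cV) => x /h; exact: clball.
have s4 : 0 < s / 4 by rewrite divr_gt0.
have s4s : s / 4 < s by lra.
pose K1 := [set x : 'rV[R]_d | sqnorm (x - y) <= s / 4].
have K1y : K1 !=set0.
  by exists y; rewrite /K1 /= subrr /sqnorm dotv0l ltW.
have [z1 /set_mem K1z1 z1min] := compact_EVT_min K1y (@compact_sqball y (s / 4))
  (cVball K1 (fun x xs => le_trans xs (ltW s4s))).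
pose mu := V.1.1 z1.
have mu0 : 0 < mu by have [] := ballQ z1 (le_lt_trans K1z1 s4s).
pose E0 := expR (- al * s).
have E00 : 0 < E0 by exact: expR_gt0.
pose K := [set x : 'rV[R]_d | s / 4 <= sqnorm (x - y)] `&`
  [set x : 'rV[R]_d | sqnorm (x - y) <= s].
have cK : compact K.
  apply: (subclosed_compact _ (@compact_sqball y s)); last by move=> x [].
  by apply: closedI; [exact: closed_sqball_ge|exact: closed_sqball].
pose Phi x := V.1.1 x + (- mu) * barrier al y x.
have cPhi : {within K, continuous Phi}.
  have cVK := cVball K (fun x Kx => proj2 Kx).
  move=> x; apply: cvgD; first exact: cVK.
  apply: cvgM; first exact: cvg_cst.
  have cb : continuous (barrier al y).
    move=> z; have [db _ _ _ _] := @C2_on_barrier setT al y z I.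
    exact: differentiable_continuous.
  exact: (continuous_subspaceT cb).
have K0 : K !=set0 by exists x0; split; rewrite /= x0s// ltW.
have [z /set_mem[Kz1 Kz2] zmin] := compact_EVT_min K0 cK cPhi.
have PhiK x : K x -> - mu * E0 <= Phi x.
  move=> Kx; apply: le_trans (zmin _ (mem_set Kx)).
  rewrite leNgt; apply/negP => Pz.
  have zs : sqnorm (z - y) < s.
    rewrite lt_neqAle Kz2 andbT; apply/negP => /eqP zs.
    move: Pz; rewrite /Phi /barrier zs -/E0.
    by have := V_ge0 (clball _ Kz2); lra.
  have zs4 : s / 4 < sqnorm (z - y).
    rewrite ltNge; apply/negP => zs4; move: Pz; rewrite /Phi.
    have h1 : mu <= V.1.1 z by apply: z1min; exact: mem_set.
    have h2 : barrier al y z <= 1.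
      rewrite -expR0 ler_expR mulNr oppr_le0 mulr_ge0 ?sqnorm_ge0// ltW//.
    have h3 : mu * barrier al y z <= mu by rewrite ler_piMr// ltW.
    have h4 : 0 < mu * E0 by rewrite mulr_gt0.
    lra.
  pose Om := [set x : 'rV[R]_d | s / 4 < sqnorm (x - y)] `&`
    [set x : 'rV[R]_d | sqnorm (x - y) < s].
  have oOm : open Om by apply: openI; [exact: open_sqball_gt|exact: open_sqball].
  have OmQ : Om `<=` Q by move=> w [_ /ballQ[]].
  have Omz : Om z by [].
  have [Qz _] := ballQ _ zs.
  have C2Phi := C2_on_lin (- mu) (C2_on_subset OmQ C2) (@C2_on_barrier Om al y).
  (* At [z] the derivatives of [Phi] show that the operator without its zeroth-order term is at
     least as large on [V] as on [mu] times the barrier. Together with [V <= mu * barrier] at [z],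
     this contradicts [LV_le0] and the strict inequality [sub]. *)
  have [|D0 D2ge] := C2_interior_min oOm C2Phi Omz.
    have : nbhs z Om by exact: open_nbhs_nbhs.
    apply: filterS => w [w1 w2]; apply: zmin; apply/mem_set.
    by split; exact: ltW.
  have tr_ge0 : 0 <= \tr (a z *m (V.2 z + (- mu) *: D2barrier al y z)).
    rewrite aE mxtrace_quad; apply: sumr_ge0 => i _.
    by rewrite dotvC; exact: D2ge.
  have DE : dotv (be z) (V.1.2 z) = mu * dotv (be z) (Dbarrier al y z).
    have := dotv0r (be z); rewrite -D0 dotvDr dotvZr; lra.
  move: tr_ge0; rewrite mulmxDr -scalemxAr mxtraceD mxtraceZ => tr_ge0.
  have LVz := LV_le0 Qz; rewrite DE in LVz.
  have subz := sub z Qz (introT andP (conj Kz1 Kz2)).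
  have h1 : mu * (k * barrier al y z) < mu * (2^-1 * \tr (a z *m D2barrier al y z) +
     dotv (be z) (Dbarrier al y z)) by rewrite ltr_pM2l.
  have h2 : V.1.1 z <= mu * barrier al y z.
    by move: Pz; rewrite /Phi; have : 0 < mu * E0 := mulr_gt0 mu0 E00; lra.
  have h3 : k * V.1.1 z <= k * (mu * barrier al y z) by rewrite ler_wpM2l.
  move: (\tr _) (\tr _) (dotv _ _) (V.1.1 z) (barrier al y z) tr_ge0 LVz h1 h3.
  move=> r1 r2 r3 r4 r5 *; lra.
pose v := y - x0.
have vE t : x0 + t *: v - y = (1 - t) *: (x0 - y).
  by rewrite /v scalerBl scale1r -scalerN opprB addrAC.
have vs t : sqnorm (x0 + t *: v - y) = (1 - t) ^+ 2 * s by rewrite vE sqnormZ x0s.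
(* Half the slope at [x0] of the comparison function: on the radius the barrier is
   [E0 * expR (al * s * (2 t - t^2))], and [expR r >= 1 + r], [2 t - t^2 >= t]. *)
pose ka := mu * E0 * (al * s).
have ka0 : 0 < ka by rewrite !mulr_gt0.
have inball t : 0 < t < 1 / 2 -> sqnorm (x0 + t *: v - y) < s.
  move=> /andP[t0 t1]; rewrite vs gtr_pMl// expr2; nra.
have Vge t : 0 < t < 1 / 2 -> ka * t <= V.1.1 (x0 + t *: v).
  move=> t01; have /andP[t0 t1] := t01.
  have Kt : K (x0 + t *: v).
    split=> /=; last exact/ltW/inball.
    rewrite vs mulrC ler_pM2r// expr2; nra.
  have := PhiK _ Kt; rewrite /Phi.
  have -> : barrier al y (x0 + t *: v) = E0 * expR (al * s * (2 * t - t ^+ 2)).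
    by rewrite /barrier vs /E0 -expRD; congr expR; ring.
  have h1 := expR_ge1Dx (al * s * (2 * t - t ^+ 2)).
  have als : 0 < al * s by rewrite mulr_gt0.
  have h2 : al * s * t <= al * s * (2 * t - t ^+ 2).
    by rewrite ler_pM2l// expr2; nra.
  have h3 : E0 * (1 + al * s * t) <= E0 * expR (al * s * (2 * t - t ^+ 2)).
    by rewrite ler_pM2l//; lra.
  have h4 : mu * (E0 * (1 + al * s * t)) <=
     mu * (E0 * expR (al * s * (2 * t - t ^+ 2))) by rewrite ler_pM2l.
  rewrite /ka; lra.
have T0 : 0 < 1 / 2 :> R by lra.
have nearQ : \forall t \near (0 : R)^'+, closure Q (x0 + t *: v).
  exists (1 / 2) => // t /=; rewrite sub0r normrN => t1 t0.
  rewrite gtr0_norm// in t1; apply: clball; apply/ltW/inball.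
  by rewrite t0.
(* [V - ka t] along the radius is minimal at [t = 0], so its right derivative there is nonnegative,
   against [DV0] and [ka > 0]. *)
suff : 0 <= dotv v (V.1.2 (x0 + 0 *: v)) - ka.
  by rewrite scale0r addr0 DV0 dotv0r; lra.
apply: (@right_min_derive_ge0 R (fun t => V.1.1 (x0 + t *: v) - ka * t)
  (fun t => dotv v (V.1.2 (x0 + t *: v)) - ka) (1 / 2)) => //.
- move=> t /inball/ballQ[/C2[dV DVE _ _ _] _].
  have h1 := is_derive_line (diff_derivable (v := v) dV).
  rewrite DVE in h1.
  have h2 : is_derive t (1 : R) (fun s : R => ka * s) ka.
    have -> : (fun s : R => ka * s) = ka *: id by [].
    by apply: is_derive_eq; rewrite [_ *: _]mulr1.
  exact: is_deriveB.
- apply: cvgB.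
    rewrite scale0r addr0; exact: ray_cvg_within cV clx0 nearQ.
  rewrite mulr0 -[X in _ --> X](mulr0 ka).
  apply: cvgM; first exact: cvg_cst.
  exact: cvg_within.
- apply: cvgB; last exact: cvg_cst.
  rewrite scale0r addr0; apply: cvg_dotv; first exact: cvg_cst.
  exact: ray_cvg_within cDV clx0 nearQ.
- move=> t t01; rewrite scale0r addr0 V0 mulr0 subrr subr_ge0.
  exact: Vge.
Qed.

(** The set where [V > 0] is open. If it were not closed in [Q], some point [p] of it would lie
    close to a zero; the zero [x0] nearest to [p] lies on the sphere of a zero-free ball, so Hopf's
    lemma gives a nonzero gradient at an interior minimum. *)
Lemma strong_maximum_principle q0 :
  connected Q -> Q q0 -> 0 < V.1.1 q0 -> forall x, Q x -> 0 < V.1.1 x.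
Proof.
move=> conQ Qq0 Vq0.
have [C2 cV cDV cD2V] := C2V.
have cVQ x : Q x -> {for x, continuous V.1.1}.
  by move=> /C2[dV _ _ _ _]; exact: differentiable_continuous.
pose P := [set x | Q x /\ 0 < V.1.1 x].
suff PQ : P = Q by move=> x; rewrite -PQ => -[].
apply: conQ; first by exists q0.
- exists P; last by apply/seteqP; split=> x // [].
  rewrite openE => x [Qx Vx]; apply: filterI; first exact: open_nbhs_nbhs.
  exact: (cvgr_gt _ (cVQ _ Qx)).
- exists (closure P); first exact: closed_closure.
  apply/seteqP; split=> x; first by move=> Px; split; [case: Px|exact: subset_closure].
  move=> [Qx clPx]; split=> //; rewrite lt_neqAle V_ge0 ?andbT; last exact: subset_closure.
  apply/negP => /eqP Vx.
  have [rho rho0 hrho] := nbhs_sqball oQ Qx.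
  (* With [|x - p|^2 < rho / 4], the closed ball about [p] through [x] stays within squared distance
     [rho] of [x], hence in [Q]. *)
  have rho4 : 0 < rho / 4 by rewrite divr_gt0.
  have [p [[Qp Vp] /= px]] : P `&` [set p : 'rV[R]_d | sqnorm (p - x) < rho / 4] !=set0.
    apply: clPx; apply: open_nbhs_nbhs; split; first exact: open_sqball.
    by rewrite /= subrr /sqnorm dotv0l.
  have xp : sqnorm (x - p) < rho / 4 by rewrite -sqnormN opprB.
  pose Bp := [set z : 'rV[R]_d | sqnorm (z - p) <= sqnorm (x - p)].
  have BpQ z : Bp z -> Q z.
    move=> Bz; apply: hrho.
    have -> : z - x = (z - p) + (p - x) by rewrite addrA subrK.
    by have := sqnormD_le (z - p) (p - x); rewrite /Bp /= in Bz; lra.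
  have cVB : {within Bp, continuous V.1.1}.
    apply: continuous_in_subspaceT => z /set_mem/BpQ; exact: cVQ.
  pose Z := Bp `&` V.1.1 @^-1` [set 0].
  have clZ : closed Z.
    by apply: closed_within_preimage cVB _; [exact: closed_sqball|exact: closed_eq].
  have cZ : compact Z.
    by apply: (subclosed_compact clZ (@compact_sqball p (sqnorm (x - p)))) => z [].
  have Z0 : Z !=set0 by exists x; split => //=; rewrite /Bp /=.
  have [x0 /set_mem[Bx0 Vx0] x0min] := compact_EVT_min Z0 cZ
    (continuous_subspaceT (@sqnorm_continuous R d p)).
  have Qx0 := BpQ _ Bx0.
  have s0 : 0 < sqnorm (x0 - p).
    apply: sqnorm_gt0; rewrite subr_eq0; apply: contraTneq Vp => <-.
    by rewrite -leNgt Vx0.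
  apply: (hopf_lemma s0 _ (subset_closure Qx0) (erefl _) Vx0).
    move=> z zs.
    have Bz : Bp z by exact: le_trans (ltW zs) Bx0.
    have Qz := BpQ _ Bz; split=> //.
    rewrite lt_neqAle V_ge0 ?andbT; last exact: subset_closure.
    apply/negP => /eqP Vz.
    have : sqnorm (x0 - p) <= sqnorm (z - p) by apply: x0min; apply/mem_set.
    by rewrite leNgt zs.
  have [] // := C2_interior_min oQ C2 Qx0 _.
  have : nbhs x0 Q by exact: open_nbhs_nbhs.
  by apply: filterS => z Qz; rewrite Vx0 V_ge0//; exact: subset_closure.
Qed.

End Hopf.
End StrongMaximumPrinciple.

(** * The controlled operator *)

Section IntegralComparison.
Variables (R : realType) (dsp : measure_display) (X : measurableType dsp).
Variable mu : probability X R.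

(** Asks for measurability only, because the cost is unbounded below in [y] and its integral may be
    [-oo]; positive and negative parts are compared separately. *)
Lemma le_integral_measurable (D : set X) (f g : X -> R) :
  measurable D -> measurable_fun D f -> measurable_fun D g ->
  (forall x, D x -> f x <= g x) ->
  (\int[mu]_(x in D) (f x)%:E <= \int[mu]_(x in D) (g x)%:E)%E.
Proof.
move=> mD mf mg fg.
have fgE : {in D, forall x, ((EFin \o f) x <= (EFin \o g) x)%E}.
  by move=> x /set_mem Dx; rewrite lee_fin fg.
have mfE : measurable_fun D (EFin \o f) by exact/measurable_EFinP.
have mgE : measurable_fun D (EFin \o g) by exact/measurable_EFinP.
rewrite integralE [leRHS]integralE; apply: leeB; apply: ge0_le_integral => //.
- exact: measurable_funepos.
- exact: measurable_funepos.
- by move=> x /mem_set; exact: funepos_le.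
- exact: measurable_funeneg.
- exact: measurable_funeneg.
- by move=> x /mem_set; exact: funeneg_le.
Qed.

Lemma integral_full_measure (D S : set X) (f : X -> R) :
  measurable D -> measurable S -> S `<=` D -> mu S = 1%E -> measurable_fun D f ->
  (\int[mu]_(x in D) (f x)%:E = \int[mu]_(x in S) (f x)%:E)%E.
Proof.
move=> mD mS SD muS mf.
have mfE : measurable_fun D (EFin \o f) by exact/measurable_EFinP.
have -> : S = D `&` S by rewrite setIC; apply/esym/setIidPl.
rewrite integral_mkcondr; apply: ae_eq_integral => //.
  apply: (measurable_restrict _ mS mD).1.
  by apply: measurable_funS mfE => // x [].
exists (~` S); split.
- exact: measurableC.
- by have := probability_setC mu mS; rewrite muS subee.
- move=> x /= nx Sx; apply: nx => Dx.
  by rewrite /patch mem_set.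
Qed.

Lemma integral_affine (S : set X) (l : X -> R) (r : R) :
  measurable S -> mu S = 1%E -> mu.-integrable S (EFin \o l) ->
  (\int[mu]_(x in S) (l x)%:E = 0)%E ->
  (\int[mu]_(x in S) (l x + r)%:E = r%:E)%E.
Proof.
move=> mS muS il l0.
have cint := finite_measure_integrable_cst mu r mS.
under eq_integral do rewrite EFinD.
rewrite (integralD mS il cint) [X in (X + _)%E]l0 add0e.
by rewrite (integral_cst mu mS r%:E) [X in (_ * X)%E]muS mule1.
Qed.

End IntegralComparison.

Lemma closure_within_closed (T U : topologicalType) (Q : set T) (f : T -> U)
    (B : set U) :
  {within closure Q, continuous f} -> closed B -> (forall x, Q x -> B (f x)) ->
  forall x, closure Q x -> B (f x).
Proof.
move=> cf clB fB x clx.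
have clC := closed_within_preimage (@closed_closure _ Q) cf clB.
suff : (closure Q `&` f @^-1` B) x by case.
have /closure_id -> := clC.
apply: closureS clx => z Qz; split; [exact: subset_closure|exact: fB].
Qed.

Lemma compact_closure_bounded (R : realType) (d : nat) (Q : set 'rV[R]_d) :
  bounded_set Q -> compact (closure Q).
Proof.
move=> [M [_ hM]]; apply: bounded_closed_compact; last exact: closed_closure.
exists (M + 1); split; first exact: num_real.
move=> r Mr x clx; apply: le_trans (ltW Mr).
have clB : closed [set x : 'rV[R]_d | `|x| <= M + 1].
  have /continuous_closedP : continuous (fun x : 'rV[R]_d => `|x|).
    exact: norm_continuous.
  by move=> /(_ _ (@closed_le R (M + 1))).
have /closure_id clE := clB.
have : closure [set x : 'rV[R]_d | `|x| <= M + 1] x.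
  by apply: closureS clx => z Qz; apply: (hM (M + 1)) => //; rewrite ltrDl.
by rewrite -clE.
Qed.

Lemma cvg_mxD (R : realType) (T : Type) (F : set_system T) (m n : nat)
    (f g : T -> 'M[R]_(m, n)) (A B : 'M[R]_(m, n)) :
  Filter F -> f @ F --> A -> g @ F --> B -> f x + g x @[x --> F] --> A + B.
Proof.
move=> FF fA gB; have := cvg_mxZD FF (cvg_cst (1 : R)) fA (cvg_cst (1 : R)) gB.
by under eq_fun do rewrite !scale1r; rewrite !scale1r; apply.
Qed.

(** * Continuity and linearity of the controlled operator and of the cost *)

Section Coefficients.
Variables (R : realType) (d : nat) (K : pseudoPMetricType R).
Variables (Q : set 'rV[R]_d) (n : 'rV[R]_d -> 'rV[R]_d).
Variables (b : 'rV[R]_d -> K -> 'rV[R]_d) (sigma : 'rV[R]_d -> 'M[R]_d).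
Variables (c : 'rV[R]_d -> K -> R).
Hypothesis b_cont : {within closure Q `*` [set: K], continuous (fun z => b z.1 z.2)}.
Hypothesis c_cont : {within closure Q `*` [set: K], continuous (fun z => c z.1 z.2)}.
Hypothesis sigma_cont : {within closure Q, continuous sigma}.

Section Filtered.
Variables (T : Type) (F : set_system T) (x : T -> 'rV[R]_d) (x0 : 'rV[R]_d).
Hypothesis FF : Filter F.
Hypothesis x_cvg : x @ F --> x0.
Hypothesis x_in : \forall t \near F, closure Q (x t).
Hypothesis x0_in : closure Q x0.

(** Limits are taken along an arbitrary filter, so that the same statements give continuity on
    [Dom], on the product of [closure Q] and [K], and along a fibre or a slice. *)
Lemma cvg_within_closure (U : topologicalType) (f : 'rV[R]_d -> U) :
  {within closure Q, continuous f} -> f (x t) @[t --> F] --> f x0.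
Proof.
move=> /subspace_continuousP cf; apply: (cvg_comp _ _ _ (cf _ x0_in)).
move=> A /= /x_cvg hA; near=> t.
have : closure Q (x t) by near: t.
by near: t.
Unshelve. all: by end_near. Qed.

Lemma cvg_within_closureK (U : topologicalType) (f : 'rV[R]_d * K -> U)
    (xi : T -> K) xi0 :
  {within closure Q `*` [set: K], continuous f} -> xi @ F --> xi0 ->
  f (x t, xi t) @[t --> F] --> f (x0, xi0).
Proof.
move=> /subspace_continuousP cf xic.
apply: (cvg_comp _ _ _ (cf (x0, xi0) (conj x0_in I))).
have pc := cvg_pair x_cvg xic.
move=> A /= /pc hA; near=> t.
have : closure Q (x t) by near: t.
have : closure Q (x t) -> A (x t, xi t).
  have : (closure Q `*` [set: K]) (x t, xi t) -> A (x t, xi t) by near: t.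
  by move=> h clx; apply: h.
by [].
Unshelve. all: by end_near. Qed.

Lemma cvg_amat : amat sigma (x t) @[t --> F] --> amat sigma x0.
Proof.
have cs := cvg_within_closure sigma_cont.
exact: (cvg_mulmx cs (cvg_trmx cs)).
Qed.

Lemma cvg_Aop (g : C2fun R d) (xi : T -> K) xi0 (y : T -> 'rV[R]_d)
    (y0 : 'rV[R]_d) :
  {within closure Q, continuous g.1.2} -> {within closure Q, continuous g.2} ->
  xi @ F --> xi0 -> y @ F --> y0 ->
  Aop sigma b g (x t, xi t, y t) @[t --> F] --> Aop sigma b g (x0, xi0, y0).
Proof.
move=> cDg cD2g xic yc; rewrite /Aop /=.
have ca := cvg_amat.
have c1 : \tr (amat sigma (x t) *m g.2 (x t)) @[t --> F] -->
    \tr (amat sigma x0 *m g.2 x0).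
  exact: (cvg_mxtrace (cvg_mulmx ca (cvg_within_closure cD2g))).
have cb : b (x t) (xi t) @[t --> F] --> b x0 xi0.
  exact: (cvg_within_closureK b_cont xic).
have c2 : y t *m (amat sigma (x t))^T @[t --> F] --> y0 *m (amat sigma x0)^T.
  exact: (cvg_mulmx yc (cvg_trmx ca)).
apply: cvgD; first by apply: cvgM; [exact: cvg_cst|exact: c1].
have c3 : b (x t) (xi t) + y t *m (amat sigma (x t))^T @[t --> F] -->
    b x0 xi0 + y0 *m (amat sigma x0)^T by exact: (cvg_mxD FF cb c2).
exact: (cvg_dotv c3 (cvg_within_closure cDg)).
Qed.

Lemma cvg_Rcost (xi : T -> K) xi0 (y : T -> 'rV[R]_d) (y0 : 'rV[R]_d) :
  xi @ F --> xi0 -> y @ F --> y0 ->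
  Rcost sigma c (x t, xi t, y t) @[t --> F] --> Rcost sigma c (x0, xi0, y0).
Proof.
move=> xic yc; rewrite /Rcost /=.
have cc : c (x t) (xi t) @[t --> F] --> c x0 xi0.
  exact: (cvg_within_closureK c_cont xic).
have cys : y t *m sigma (x t) @[t --> F] --> y0 *m sigma x0.
  exact: (cvg_mulmx yc (cvg_within_closure sigma_cont)).
apply: cvgB => //; apply: cvgM; first exact: cvg_cst.
exact: (cvg_dotv cys cys).
Qed.

End Filtered.

Lemma closed_Dom : closed (Dom K Q).
Proof.
have -> : Dom K Q = (fst \o fst) @^-1` closure Q.
  apply/seteqP; split => -[[x xi] y] /=; first by case=> -[].
  by move=> clx; split.
have /continuous_closedP : continuous ((fst \o fst) : Xspace R d K -> 'rV[R]_d).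
  by move=> z; apply: cvg_comp; [exact: cvg_fst|exact: cvg_fst].
by move=> /(_ _ (@closed_closure _ Q)).
Qed.

Let dom_filter (z : Xspace R d K) : Dom K Q z ->
  [/\ z'.1.1 @[z' --> within (Dom K Q) (nbhs z)] --> z.1.1,
      z'.1.2 @[z' --> within (Dom K Q) (nbhs z)] --> z.1.2,
      z'.2 @[z' --> within (Dom K Q) (nbhs z)] --> z.2
    & \forall z' \near within (Dom K Q) (nbhs z), closure Q z'.1.1].
Proof.
move=> Dz.
have w : within (Dom K Q) (nbhs z) --> z by exact: cvg_within.
have c1 : z'.1 @[z' --> within (Dom K Q) (nbhs z)] --> z.1.
  by apply: (cvg_comp _ _ w); case: z {Dz w} => ? ?; exact: cvg_fst.
have c2 : z'.2 @[z' --> within (Dom K Q) (nbhs z)] --> z.2.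
  by apply: (cvg_comp _ _ w); case: z {Dz w c1} => ? ?; exact: cvg_snd.
split=> //.
- by apply: (cvg_comp _ _ c1); case: z.1 => ? ?; exact: cvg_fst.
- by apply: (cvg_comp _ _ c1); case: z.1 => ? ?; exact: cvg_snd.
- by apply: filterS (withinT (Dom K Q) _) => z' [[]].
Qed.

Lemma within_Dom_Aop (g : C2fun R d) :
  C2_closure Q g.1.1 g.1.2 g.2 -> {within Dom K Q, continuous (Aop sigma b g)}.
Proof.
move=> [_ _ cDg cD2g]; apply/subspace_continuousP => -[[x xi] y] Dz.
have [c1 c2 c3 near1] := dom_filter Dz.
have := cvg_Aop _ c1 near1 (proj1 (proj1 Dz)) cDg cD2g c2 c3.
by under eq_fun do rewrite -!surjective_pairing; apply.
Qed.

Lemma within_Dom_Rcost : {within Dom K Q, continuous (Rcost sigma c)}.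
Proof.
apply/subspace_continuousP => -[[x xi] y] Dz.
have [c1 c2 c3 near1] := dom_filter Dz.
have := cvg_Rcost _ c1 near1 (proj1 (proj1 Dz)) c2 c3.
by under eq_fun do rewrite -!surjective_pairing; apply.
Qed.

Lemma Aop_lin (f g : C2fun R d) (t : R) (z : Xspace R d K) :
  Aop sigma b ((fun x => f.1.1 x + t * g.1.1 x), (fun x => f.1.2 x + t *: g.1.2 x),
    (fun x => f.2 x + t *: g.2 x)) z = Aop sigma b f z + t * Aop sigma b g z.
Proof.
rewrite /Aop/= mulmxDr -scalemxAr mxtraceD mxtraceZ dotvDr dotvZr; ring.
Qed.

Lemma C2gamma_lin (f g : C2fun R d) (t : R) :
  C2gamma Q sigma n f -> C2gamma Q sigma n g ->
  C2gamma Q sigma n ((fun x => f.1.1 x + t * g.1.1 x),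
    (fun x => f.1.2 x + t *: g.1.2 x), (fun x => f.2 x + t *: g.2 x)).
Proof.
move=> [[C2f cf cDf cD2f] fb] [[C2g cg cDg cD2g] gb]; split; last first.
  by move=> x bx /=; rewrite dotvDl dotvZl fb// gb// mulr0 addr0.
split=> /=; first exact: C2_on_lin.
- move=> x; apply: cvgD; first exact: cf.
  by apply: cvgM; [exact: cvg_cst|exact: cg].
- move=> x; have := cvg_mxZD _ (cvg_cst (1 : R)) (cDf x) (cvg_cst t) (cDg x).
  by under eq_fun do rewrite scale1r; rewrite scale1r; apply.
- move=> x; have := cvg_mxZD _ (cvg_cst (1 : R)) (cD2f x) (cvg_cst t) (cD2g x).
  by under eq_fun do rewrite scale1r; rewrite scale1r; apply.
Qed.

End Coefficients.

(** * The principal eigenpair *)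

Lemma within_slice (R : realType) (d : nat) (K : pseudoPMetricType R)
    (Q : set 'rV[R]_d) (U : topologicalType) (f : 'rV[R]_d * K -> U) (xi : K) :
  {within closure Q `*` [set: K], continuous f} ->
  {within closure Q, continuous (fun x => f (x, xi))}.
Proof.
move=> cf; apply/subspace_continuousP => z clz.
apply: (@cvg_within_closureK R d K Q _ (within (closure Q) (nbhs z)) id z _ _ _
  clz U f (fun=> xi) xi cf (cvg_cst _)).
  exact: cvg_within.
exact: withinT.
Qed.

Lemma within_amat (R : realType) (d : nat) (D : set 'rV[R]_d)
    (sigma : 'rV[R]_d -> 'M[R]_d) :
  {within D, continuous sigma} -> {within D, continuous (amat sigma)}.
Proof.
by move=> cs z; exact: (cvg_mulmx (cs z) (cvg_trmx (cs z))).
Qed.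

Lemma within_quad (R : realType) (d : nat) (D : set 'rV[R]_d)
    (A : 'rV[R]_d -> 'M[R]_d) v :
  {within D, continuous A} -> {within D, continuous (fun x => dotv (v *m A x) v)}.
Proof.
move=> cA; apply/subspace_continuousP => z Dz.
have cAz := (subspace_continuousP _ _).1 cA z Dz.
have c1 : v *m A y @[y --> within D (nbhs z)] --> v *m A z.
  exact: (@cvg_mulmx R _ (within D (nbhs z)) _ _ _ _ (fun=> v) A v (A z) (cvg_cst _) cAz).
exact: (@cvg_dotv R _ (within D (nbhs z)) _ d (fun y => v *m A y) (fun=> v) _ _ c1 (cvg_cst _)).
Qed.

Lemma measurable_Dom (R : realType) (d : nat) (K : pseudoPMetricType R)
    (Q : set 'rV[R]_d) : measurable (Dom K Q : set (BorelX R d K)).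
Proof.
rewrite -(setCK (Dom K Q)); apply: measurableC; apply: sub_sigma_algebra.
exact/closed_openC/closed_Dom.
Qed.

Lemma measurable_within_Dom (R : realType) (d : nat) (K : pseudoPMetricType R)
    (Q : set 'rV[R]_d) (f : Xspace R d K -> R) :
  {within Dom K Q, continuous f} ->
  measurable_fun (Dom K Q : set (BorelX R d K)) f.
Proof.
pose T : pseudoPMetricType R := HB.pack (Xspace R d K)
  (Pointed.on (Xspace R d K)) (PseudoMetric.on (Xspace R d K)).
exact: (@within_continuous_measurable R T _ f (@closed_Dom R d K Q)).
Qed.

Section PrincipalEigenpair.
Variables (R : realType) (d : nat) (K : pseudoPMetricType R).
Variables (Q : set 'rV[R]_d) (n : 'rV[R]_d -> 'rV[R]_d).
Variables (b : 'rV[R]_d -> K -> 'rV[R]_d) (sigma : 'rV[R]_d -> 'M[R]_d).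
Variables (c : 'rV[R]_d -> K -> R) (rho lam : R) (V : C2fun R d).
Hypothesis oQ : open Q.
Hypothesis conQ : connected Q.
Hypothesis bndQ : bounded_set Q.
Hypothesis Q0 : Q 0.
Hypothesis bdQ : C2_boundary_normal Q n.
Hypothesis cK : compact [set: K].
Hypothesis b_cont : {within closure Q `*` [set: K], continuous (fun z => b z.1 z.2)}.
Hypothesis c_cont : {within closure Q `*` [set: K], continuous (fun z => c z.1 z.2)}.
Hypothesis sigma_cont : {within closure Q, continuous sigma}.
Hypothesis lam0 : 0 < lam.
Hypothesis eig_lam : forall x, Q x -> forall e, eigenvalue (amat sigma x) e -> lam <= e.
Hypothesis VC : C2gamma Q sigma n V.
Hypothesis V_ge0 : forall x, closure Q x -> 0 <= V.1.1 x.
Hypothesis V01 : V.1.1 0 = 1.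
Hypothesis VG : forall x, Q x -> Gop sigma b c V x = rho * V.1.1 x.

Let ccQ : compact (closure Q) := compact_closure_bounded bndQ.

Let C2V : C2_closure Q V.1.1 V.1.2 V.2 := proj1 VC.

(** The eigenvalue bound is turned into a bound on the quadratic form, which passes from [Q] to its
    closure by continuity. *)
Lemma elliptic_closure x : closure Q x ->
  forall v, lam * sqnorm v <= dotv (v *m amat sigma x) v.
Proof.
move=> clx v.
apply: (closure_within_closed (within_quad (v := v) (within_amat sigma_cont))
  (@closed_ge R (lam * sqnorm v)) _ clx).
move=> z Qz; apply: rayleigh_lower_bound.
  exact: amat_sym.
exact: eig_lam.
Qed.

Lemma elliptic_gt0 x : closure Q x ->
  forall v, v != 0 -> 0 < dotv (v *m amat sigma x) v.
Proof.
move=> clx v v0; apply: lt_le_trans (elliptic_closure clx v).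
by rewrite mulr_gt0// sqnorm_gt0.
Qed.

(* Its maximum over xi is  G V - rho V. *)
Definition residual x xi : R :=
  Aop sigma b V (x, xi, 0) + (c x xi - rho) * V.1.1 x.

Lemma residualE x xi : residual x xi = 2^-1 * \tr (amat sigma x *m V.2 x) +
  (dotv (b x xi) (V.1.2 x) + c x xi * V.1.1 x) - rho * V.1.1 x.
Proof. by rewrite /residual /Aop /= mul0mx addr0; ring. Qed.

Lemma cvg_residual (T : Type) (F : set_system T) (x : T -> 'rV[R]_d)
    (xi : T -> K) x0 xi0 : Filter F ->
  x @ F --> x0 -> (\forall t \near F, closure Q (x t)) -> closure Q x0 ->
  xi @ F --> xi0 -> residual (x t) (xi t) @[t --> F] --> residual x0 xi0.
Proof.
move=> FF xc xn clx0 xic; have [_ cV cDV cD2V] := C2V.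
apply: cvgD.
  exact: (cvg_Aop b_cont sigma_cont FF xc xn clx0 (y := fun=> 0) (y0 := 0)
    cDV cD2V xic (cvg_cst _)).
apply: cvgM; last exact: cvg_within_closure cV.
apply: cvgB; last exact: cvg_cst.
exact: (cvg_within_closureK FF xc xn clx0 c_cont xic).
Qed.

Lemma within_residual :
  {within closure Q `*` [set: K], continuous (fun z => residual z.1 z.2)}.
Proof.
apply/subspace_continuousP => -[x xi] [/= clx _].
set W := within _ _.
have w : W --> (x, xi) by exact: cvg_within.
have c1 : z.1 @[z --> W] --> x by apply: (cvg_comp _ _ w); exact: cvg_fst.
have c2 : z.2 @[z --> W] --> xi by apply: (cvg_comp _ _ w); exact: cvg_snd.
apply: (cvg_residual _ c1 _ clx c2).
by apply: filterS (withinT (closure Q `*` [set: K]) _) => z [].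
Qed.

Let fibre_cont x : closure Q x -> {within [set: K], continuous (residual x)}.
Proof.
move=> clx; apply: continuous_subspaceT => xi.
by apply: cvg_residual => //; [exact: cvg_cst|exact: nearW].
Qed.

Let fibre_max x : closure Q x -> exists xi, forall xi', residual x xi' <= residual x xi.
Proof.
move=> clx.
have K0 : [set: K] !=set0 by exists point.
have [xi _ ximax] := compact_EVT_max K0 cK (fibre_cont clx).
by exists xi => xi'; apply: ximax; exact/mem_set.
Qed.

Let interior_residual x : Q x ->
  (forall xi, residual x xi <= 0) /\ exists xi, residual x xi = 0.
Proof.
move=> Qx; have [xi ximax] := fibre_max (subset_closure Qx).
have := VG Qx; rewrite /Gop.
set E := [set _ | _ in _] => GE.
pose g xi := dotv (b x xi) (V.1.2 x) + c x xi * V.1.1 x.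
have gmax xi' : g xi' <= g xi.
  by have := ximax xi'; rewrite !residualE -/(g xi) -/(g xi'); lra.
have supE : sup E = g xi.
  apply/eqP; rewrite eq_le; apply/andP; split.
    apply: ge_sup; first by exists (g xi), xi.
    by move=> _ [xi' _ <-]; exact: gmax.
  apply: ub_le_sup; last by exists xi.
  by exists (g xi) => _ [xi' _ <-]; exact: gmax.
have r0 : residual x xi = 0 by rewrite residualE -/(g xi) -supE; lra.
split; last by exists xi.
by move=> xi'; rewrite -r0; exact: ximax.
Qed.

Lemma residual_le0 x xi : closure Q x -> residual x xi <= 0.
Proof.
move=> clx.
apply: (closure_within_closed (within_slice (xi := xi) within_residual)
  (@closed_le R 0) _ clx).
by move=> z /interior_residual[h _]; exact: h.
Qed.

(** The zero set of [residual] over [closure Q] is compact because [K] is, so its projection is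
    closed; it contains [Q], hence [closure Q]. *)
Lemma residual_eq0 x : closure Q x -> exists xi, residual x xi = 0.
Proof.
pose Z := (closure Q `*` [set: K]) `&` (fun z => residual z.1 z.2) @^-1` [set 0].
have clD : closed (closure Q `*` [set: K]).
  have -> : closure Q `*` [set: K] = fst @^-1` closure Q.
    by apply/seteqP; split=> -[z xi]//= [].
  have /continuous_closedP : continuous (@fst 'rV[R]_d K).
    by move=> -[z xi]; exact: cvg_fst.
  by move=> /(_ _ (@closed_closure _ Q)).
have cZ : compact Z.
  apply: (subclosed_compact _ (compact_setX ccQ cK)); last by move=> z [].
  by apply: closed_within_preimage within_residual _ => //; exact: closed_eq.
have clpZ : closed (fst @` Z).
  apply: compact_closed; first exact: norm_hausdorff.
  apply: continuous_compact => //; apply: continuous_subspaceT => -[z xi].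
  exact: cvg_fst.
move=> clx.
have : (fst @` Z) x.
  have /closure_id -> := clpZ; apply: closureS clx => z Qz.
  have [_ [xi r0]] := interior_residual Qz.
  exists (z, xi) => //; split=> //; split=> //; exact: subset_closure.
by move=> [[z xi] [_ /= r0] <-]; exists xi.
Qed.

(** Fixing the control [point] makes [residual <= 0] a linear inequality, and [k >= rho - c] with
    [V >= 0] gives it the zeroth-order term [- k]. Positivity inside [Q] spreads from [V 0 = 1]. A
    zero on the boundary would be a minimum over [closure Q], where the gradient vanishes, against
    Hopf's lemma. *)
Lemma eigenfunction_gt0 x : closure Q x -> 0 < V.1.1 x.
Proof.
have [C2 cV cDV cD2V] := C2V.
have clQ0 : closure Q !=set0 by exists 0; exact: subset_closure.
have bounded_above (f : 'rV[R]_d -> R) : {within closure Q, continuous f} ->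
    exists2 M : R, 0 <= M & forall z, closure Q z -> f z <= M.
  move=> cf; have [z _ zmax] := compact_EVT_max clQ0 ccQ cf.
  exists `|f z| => // y cly; apply: le_trans (ler_norm _).
  by apply: zmax; exact/mem_set.
have [A0 A0_ge0 trA] : exists2 M : R, 0 <= M &
    forall z, closure Q z -> \tr (amat sigma z) <= M.
  apply: (bounded_above); apply/subspace_continuousP => z clz.
  have caz := (subspace_continuousP _ _).1 (within_amat sigma_cont) z clz.
  exact: (cvg_mxtrace caz).
have bpt := within_slice (xi := point) b_cont.
have cpt := within_slice (xi := point) c_cont.
have [B B_ge0 bB] : exists2 M : R, 0 <= M &
    forall z, closure Q z -> `|b z point| <= M.
  apply: (bounded_above); apply/subspace_continuousP => z clz.
  exact: (cvg_norm ((subspace_continuousP _ _).1 bpt z clz)).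
have [k k_ge0 ck] : exists2 M : R, 0 <= M &
    forall z, closure Q z -> rho - c z point <= M.
  apply: (bounded_above); apply/subspace_continuousP => z clz.
  exact: (cvgB (cvg_cst rho) ((subspace_continuousP _ _).1 cpt z clz)).
have LV z : Q z -> 2^-1 * \tr (amat sigma z *m V.2 z) +
    dotv (b z point) (V.1.2 z) - k * V.1.1 z <= 0.
  move=> Qz; have clz := subset_closure Qz.
  have := residual_le0 point clz; rewrite residualE => r0.
  have := ler_wpM2r (V_ge0 clz) (ck z clz).
  by move: (V.1.1 z) (c z point) (\tr _) (dotv _ _) r0; move=> *; lra.
have a_lam z : Q z -> forall v, lam * sqnorm v <= dotv (v *m amat sigma z) v.
  by move=> Qz; apply: elliptic_closure; exact: subset_closure.
have trA' z : Q z -> \tr (amat sigma z) <= A0.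
  by move=> Qz; apply: trA; exact: subset_closure.
have bB' z : Q z -> `|b z point| <= B.
  by move=> Qz; apply: bB; exact: subset_closure.
have aE z : amat sigma z = sigma z *m (sigma z)^T by [].
have V0gt : 0 < V.1.1 0 by rewrite V01.
have VQ := strong_maximum_principle oQ aE lam0 a_lam trA' bB' A0_ge0 B_ge0 k_ge0
  C2V V_ge0 LV conQ Q0 V0gt.
move=> clx; have [Qx|nQx] := pselect (Q x); first exact: VQ.
rewrite lt_neqAle V_ge0// andbT; apply/negP => /eqP/esym Vx.
have bx : bdry Q x by [].
have [_ _ [y [s [s0 xs hs]]]] := boundary_point_geometry bdQ bx.
apply: (hopf_lemma aE lam0 a_lam trA' bB' A0_ge0 B_ge0 k_ge0 C2V V_ge0 LV s0 _ clx xs Vx).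
  by move=> z /hs Qz; split=> //; exact: VQ.
have [] // := C2gamma_min oQ bdQ VC elliptic_gt0 clx _.
by move=> z clz; rewrite Vx V_ge0.
Qed.

Definition log_eigenfunction : C2fun R d :=
  ((fun x => ln (V.1.1 x)), (fun x => (V.1.1 x)^-1 *: V.1.2 x),
   (fun x => (V.1.1 x)^-1 *: V.2 x +
      (- (V.1.1 x) ^- 2) *: ((V.1.2 x)^T *m V.1.2 x))).

Lemma log_eigenfunction_C2gamma : C2gamma Q sigma n log_eigenfunction.
Proof.
have [C2 cV cDV cD2V] := C2V.
have h2_cont (t : R) : 0 < t -> {for t, continuous (fun s : R => - s ^- 2)}.
  move=> t0; apply: cvgN; apply: cvgV; first by rewrite expf_neq0// gt_eqF.
  exact: exprn_continuous.
have inv_cont (t : R) : 0 < t -> {for t, continuous (fun s : R => s^-1)}.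
  by move=> t0; apply: inv_continuous; rewrite gt_eqF.
split; last first.
  by move=> x bx /=; rewrite dotvZl (proj2 VC)// mulr0.
split=> /=.
- apply: (@C2_on_comp R d Q V.1.1 V.1.2 V.2 (@ln R) (fun s => s^-1)
    (fun s => - s ^- 2)) => // x Qx.
  have Vx := eigenfunction_gt0 (subset_closure Qx).
  split; [exact: is_derive1_ln| |exact: h2_cont].
  have := @is_deriveV R id (V.1.1 x) 1 1 _ (is_derive_id _ _).
  rewrite gt_eqF// => /(_ isT) h; apply: is_derive_eq h _.
  by rewrite [_ *: _]mulr1.
- apply/subspace_continuousP => x clx.
  have cVx := (subspace_continuousP _ _).1 cV x clx.
  apply: (cvg_comp _ _ cVx); apply: continuous_ln.
  exact: eigenfunction_gt0.
- apply/subspace_continuousP => x clx.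
  have cVx := (subspace_continuousP _ _).1 cV x clx.
  have cDVx := (subspace_continuousP _ _).1 cDV x clx.
  have ci := cvg_comp _ _ cVx (inv_cont _ (eigenfunction_gt0 clx)).
  exact: (cvgZ ci cDVx).
- apply/subspace_continuousP => x clx.
  have cVx := (subspace_continuousP _ _).1 cV x clx.
  have cDVx := (subspace_continuousP _ _).1 cDV x clx.
  have cD2Vx := (subspace_continuousP _ _).1 cD2V x clx.
  have ci := cvg_comp _ _ cVx (inv_cont _ (eigenfunction_gt0 clx)).
  have ci2 := cvg_comp _ _ cVx (h2_cont _ (eigenfunction_gt0 clx)).
  have co : (V.1.2 y)^T *m V.1.2 y @[y --> within (closure Q) (nbhs x)] -->
      (V.1.2 x)^T *m V.1.2 x by exact: (cvg_mulmx (cvg_trmx cDVx) cDVx).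
  exact: (cvg_mxZD _ ci cD2Vx ci2 co).
Qed.

(** The square collects three terms: the gradient part of the Hessian of [ln V], the drift term in
    [a y], and the quadratic cost of [y]. *)
Lemma log_eigenfunction_identity x xi y : closure Q x ->
  Aop sigma b log_eigenfunction (x, xi, y) + Rcost sigma c (x, xi, y) =
  rho + (V.1.1 x)^-1 * residual x xi -
  2^-1 * sqnorm ((y - log_eigenfunction.1.2 x) *m sigma x).
Proof.
move=> clx; have Vx := eigenfunction_gt0 clx.
have Vn0 : V.1.1 x != 0 by rewrite gt_eqF.
rewrite residualE /Aop /Rcost /log_eigenfunction /=.
rewrite mulmxDr -!scalemxAr mxtraceD !mxtraceZ mxtrace_outer amat_quad.
rewrite amat_sym dotvDl !dotvZr.
have -> : dotv (y *m amat sigma x) (V.1.2 x) =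
    dotv (y *m sigma x) (V.1.2 x *m sigma x).
  by rewrite /amat mulmxA dotv_mulmxl trmxK.
rewrite mulmxBl -scalemxAl sqnormD sqnormN sqnormZ dotvNr dotvZr.
by field.
Qed.

Lemma Aop_Rcost_le z : Dom K Q z ->
  Aop sigma b log_eigenfunction z + Rcost sigma c z <= rho.
Proof.
case: z => -[x xi] y [[/= clx _] _]; rewrite log_eigenfunction_identity//.
have h1 : (V.1.1 x)^-1 * residual x xi <= 0.
  by rewrite pmulr_rle0 ?invr_gt0 ?eigenfunction_gt0// residual_le0.
have := sqnorm_ge0 ((y - log_eigenfunction.1.2 x) *m sigma x); lra.
Qed.

(** Contact set where the upper bound [rho] is attained; written as the preimage of a point, it is
    closed at once. *)
Let S : set (Xspace R d K) := Dom K Q `&`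
  (fun z => Aop sigma b log_eigenfunction z + Rcost sigma c z) @^-1` [set rho].

Let clS : closed S.
Proof.
apply: closed_within_preimage; first exact: closed_Dom.
  have cA := within_Dom_Aop b_cont sigma_cont (proj1 log_eigenfunction_C2gamma).
  have cR := within_Dom_Rcost c_cont sigma_cont.
  by move=> z; apply: cvgD; [exact: cA|exact: cR].
exact: closed_eq.
Qed.

Let S_graph z : S z -> z.2 = log_eigenfunction.1.2 z.1.1.
Proof.
case: z => -[x xi] y [[[/= clx _] _]] /=; rewrite log_eigenfunction_identity//.
have h1 : (V.1.1 x)^-1 * residual x xi <= 0.
  by rewrite pmulr_rle0 ?invr_gt0 ?eigenfunction_gt0// residual_le0.
have := sqnorm_ge0 ((y - log_eigenfunction.1.2 x) *m sigma x).
set w := y - _ => h2 h3.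
have w0 : sqnorm (w *m sigma x) = 0 by lra.
apply/eqP; rewrite -subr_eq0 -[_ - _]/w; apply/negPn/negP => wn0.
by have := elliptic_gt0 clx wn0; rewrite amat_quad w0 ltxx.
Qed.

Let S_point x xi : closure Q x -> residual x xi = 0 ->
  S (x, xi, log_eigenfunction.1.2 x).
Proof.
move=> clx r0; split=> //=.
rewrite log_eigenfunction_identity// r0 subrr mul0mx /sqnorm dotv0l; lra.
Qed.

(** Although [y] ranges over the whole space, on [S] it equals the gradient of [ln V]; [S] is closed
    in the graph of that gradient, a continuous image of a compact set. *)
Let cS : compact S.
Proof.
have [[_ _ cDU _] _] := log_eigenfunction_C2gamma.
pose gr (z : 'rV[R]_d * K) : Xspace R d K := (z, log_eigenfunction.1.2 z.1).
have cgr : {within closure Q `*` [set: K], continuous gr}.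
  apply/subspace_continuousP => -[x xi] [/= clx _].
  set W := within _ _.
  have w : W --> (x, xi) by exact: cvg_within.
  have c1 : z.1 @[z --> W] --> x by apply: (cvg_comp _ _ w); exact: cvg_fst.
  have near1 : \forall z \near W, closure Q z.1.
    by apply: filterS (withinT (closure Q `*` [set: K]) _) => z [].
  have c2 : log_eigenfunction.1.2 z.1 @[z --> W] --> log_eigenfunction.1.2 x.
    exact: (cvg_within_closure _ c1 near1 clx cDU).
  have w1 : z @[z --> W] --> (x, xi) by exact: w.
  exact: (cvg_pair w1 c2).
have cim := continuous_compact cgr (compact_setX ccQ cK).
apply: (subclosed_compact clS cim) => z Sz; exists z.1.
  by case: Sz => -[].
by rewrite /gr -(S_graph Sz); case: z Sz.
Qed.

(** On [S] the cost equals [rho] minus [A] of [ln V], so [A g] plus the cost is [rho] plus the value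
    of [A] at the difference of [g] and [ln V], a function that the measure annihilates. *)
Lemma optimal_measure : exists mu : probability (BorelX R d K) R,
  [/\ MAQ Q sigma n b mu,
      forall g, C2gamma Q sigma n g -> Fobj Q sigma b c g mu = rho%:E
    & (\int[mu]_(z in Dom K Q) (Rcost sigma c z)%:E = rho%:E)%E].
Proof.
have UC := log_eigenfunction_C2gamma.
pose L : set (Xspace R d K -> R) :=
  [set f | exists2 g, C2gamma Q sigma n g & f = Aop sigma b g].
have SD : S `<=` Dom K Q by move=> z [].
have Llin f g t : L f -> L g -> L (fun z => f z + t * g z).
  move=> [u uC ->] [v vC ->]; have uvC := C2gamma_lin t uC vC.
  by eexists; [exact: uvC|apply/funext => z; rewrite Aop_lin].
have L_add f g : L f -> L g -> L (fun z => f z + g z).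
  move=> Lf Lg; have := Llin _ _ 1 Lf Lg.
  by congr L; apply/funext => z; rewrite mul1r.
have L_scale t f : L f -> L (fun z => t * f z).
  (* [f + (t - 1) f = t f]. *)
  move=> Lf; have := Llin _ _ (t - 1) Lf Lf.
  by congr L; apply/funext => z; ring.
have LU : L (Aop sigma b log_eigenfunction) by exists log_eigenfunction.
have LDom f : L f -> {within Dom K Q, continuous f}.
  by move=> [g [gC _] ->]; exact: within_Dom_Aop.
have L_cont f : L f -> {within S, continuous f}.
  by move=> /LDom; exact: continuous_subspaceW.
have clQ0 : closure Q !=set0 by exists 0; exact: subset_closure.
have L_pos f : L f -> exists2 z, S z & 0 <= f z.
  move=> [g gC ->].
  have [[_ cg _ _] _] := gC.
  have [x0 /set_mem clx0 x0min] := compact_EVT_min clQ0 ccQ cg.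
  have [|D0 D2] := C2gamma_min oQ bdQ gC elliptic_gt0 clx0.
    by move=> y cly; apply: x0min; exact/mem_set.
  have [xi r0] := residual_eq0 clx0.
  exists (x0, xi, log_eigenfunction.1.2 x0); first exact: S_point.
  rewrite /Aop /= D0 dotv0r addr0 mulr_ge0 ?invr_ge0// mxtrace_quad.
  by apply: sumr_ge0 => i _; rewrite dotvC.
have L0 : L !=set0 by exists (Aop sigma b log_eigenfunction).
pose T : pseudoPMetricType R := HB.pack (Xspace R d K)
  (Pointed.on (Xspace R d K)) (PseudoMetric.on (Xspace R d K)).
have [mu [muS muL]] : exists mu : probability (BorelX R d K) R,
    mu S = 1%E /\ forall l, L l -> (\int[mu]_(z in S) (l z)%:E = 0)%E.
  exact: (@annihilating_probability R T S L cS clS L0 L_add L_scale L_cont L_pos).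
pose X := BorelX R d K.
have mD : measurable (Dom K Q : set X) by exact: measurable_Dom.
have mS : measurable (S : set X).
  rewrite -(setCK S); apply: measurableC.
  by apply: sub_sigma_algebra; exact: closed_openC.
have Sint f : L f -> mu.-integrable (S : set X) (EFin \o f).
  move=> Lf; apply: (@measurable_bounded_integrable _ X R mu) => //.
  - by rewrite [X in (X < _)%E]muS ltry.
  - exact: (@within_continuous_measurable R T _ f clS (L_cont _ Lf)).
  - have [M [Mr h]] := compact_bounded (continuous_compact (L_cont _ Lf) cS).
    exists M; split=> // y My x Sx; apply: (h y My); by exists x.
have toS (f : Xspace R d K -> R) : {within Dom K Q, continuous f} ->
    (\int[mu]_(z in Dom K Q) (f z)%:E = \int[mu]_(z in S) (f z)%:E)%E.
  by move=> cf; apply: integral_full_measure => //; exact: measurable_within_Dom.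
have cR := within_Dom_Rcost c_cont sigma_cont.
(* Reduces both integrals involving the cost to a function of [L] plus the constant [rho]. *)
have onS (f l : Xspace R d K -> R) : {within Dom K Q, continuous f} -> L l ->
    (forall z, S z -> f z = l z + rho) ->
    (\int[mu]_(z in Dom K Q) (f z)%:E = rho%:E)%E.
  move=> cf Ll fl; rewrite toS// -[RHS](integral_affine rho mS muS (Sint _ Ll) (muL _ Ll)).
  by apply: eq_integral => z /set_mem Sz; rewrite fl.
have muD : mu (Dom K Q) = 1%E.
  apply/eqP; rewrite eq_le probability_le1//= -muS.
  by apply: le_measure => //; rewrite inE.
exists mu; split.
- split=> // g gC.
  have Lg : L (Aop sigma b g) by exists g.
  split; last by rewrite toS; [exact: muL|exact: LDom].
  have cabs : {within Dom K Q, continuous (fun z => `|Aop sigma b g z|)}.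
    by move=> z; apply: cvg_norm; exact: (LDom _ Lg).
  rewrite toS//; have /integrableP[_] := Sint _ Lg.
  by under eq_integral do rewrite /=.
- move=> g gC; have Lg : L (Aop sigma b g) by exists g.
  apply: (onS _ _ _ (Llin _ _ (-1) Lg LU)).
    by move=> z; apply: cvgD; [exact: (LDom _ Lg)|exact: cR].
  by move=> z [_ /= <-]; ring.
- apply: (onS _ _ _ (L_scale (-1) _ LU)) => // z [_ /= <-]; ring.
Qed.

End PrincipalEigenpair.

(** * Saddle point and minimax formulas *)

Theorem theorem2p2 (R : realType) (d : nat) (K : pseudoPMetricType R)
  (Q : set 'rV[R]_d) (n : 'rV[R]_d -> 'rV[R]_d)
  (b : 'rV[R]_d -> K -> 'rV[R]_d) (sigma : 'rV[R]_d -> 'M[R]_d)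
  (c : 'rV[R]_d -> K -> R) (rho : R) (V : C2fun R d) :
  (0 < d)%N ->
  (* Q: bounded C^2 domain containing 0, with outward unit normal n *)
  open Q -> connected Q -> bounded_set Q -> Q 0 ->
  C2_boundary_normal Q n ->
  (* K compact metrizable *)
  compact [set: K] -> hausdorff_space K ->
  (* b continuous, Lipschitz in x uniformly in xi *)
  {within closure Q `*` [set: K], continuous (fun z => b z.1 z.2)} ->
  (exists L : R, forall xi x y, closure Q x -> closure Q y ->
     enorm (b x xi - b y xi) <= L * enorm (x - y)) ->
  (* sigma C^1 on closure Q with Hoelder continuous derivatives *)
  (exists Dsigma : 'I_d -> 'I_d -> 'rV[R]_d -> 'rV[R]_d,
     (forall i j, C1_closure Q (fun x => sigma x i j) (Dsigma i j)) /\
     exists alpha C : R, [/\ 0 < alpha, alpha <= 1 &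
       forall i j x y, closure Q x -> closure Q y ->
         enorm (Dsigma i j x - Dsigma i j y) <= C * powR (enorm (x - y)) alpha]) ->
  (* minimum eigenvalue of a = sigma sigma^T bounded away from 0 on Q *)
  (exists lam : R, 0 < lam /\ forall x, Q x ->
     forall e, eigenvalue (amat sigma x) e -> lam <= e) ->
  (* c continuous, Lipschitz in x uniformly in xi *)
  {within closure Q `*` [set: K], continuous (fun z => c z.1 z.2)} ->
  (exists L : R, forall xi x y, closure Q x -> closure Q y ->
     `|c x xi - c y xi| <= L * enorm (x - y)) ->
  (* (rho, V) is the principal eigenpair *)
  C2gamma Q sigma n V ->
  (forall x, closure Q x -> 0 <= V.1.1 x) ->
  V.1.1 0 = 1 ->
  (forall x, Q x -> Gop sigma b c V x = rho * V.1.1 x) ->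
  let F := Fobj Q sigma b c in
  let C2g := C2gamma Q sigma n in
  let P := Pset K Q in
  let M := MAQ Q sigma n b in
  [/\ rho%:E = ereal_inf [set ereal_sup [set F g mu | mu in P] | g in C2g],
      rho%:E = ereal_sup [set ereal_inf [set F g mu | g in C2g] | mu in P],
      rho%:E = ereal_inf [set ereal_sup [set F g mu | mu in M] | g in C2g],
      rho%:E = ereal_sup [set ereal_inf [set F g mu | g in C2g] | mu in M]
    & rho%:E = ereal_sup [set (\int[mu]_(z in Dom K Q) (Rcost sigma c z)%:E)%E
                         | mu in M]].
Proof.
move=> d0 oQ conQ bndQ Q0 bdQ cK hK b_cont bL [Ds [Ds1 _]] [lam [lam0 eig]]
  c_cont cL VC V_ge0 V01 VG F C2g P M.
have sigma_cont : {within closure Q, continuous sigma}.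
  apply/subspace_continuousP => x clx; apply: cvg_mx_entries => i j.
  by have [_ cs _] := Ds1 i j; exact: ((subspace_continuousP _ _).1 cs x clx).
have UC : C2g (log_eigenfunction V).
  exact: (log_eigenfunction_C2gamma oQ conQ bndQ Q0 bdQ cK b_cont c_cont
    sigma_cont lam0 eig VC V_ge0 V01 VG).
have AR_le z : Dom K Q z ->
    Aop sigma b (log_eigenfunction V) z + Rcost sigma c z <= rho.
  exact: (Aop_Rcost_le oQ conQ bndQ Q0 bdQ cK b_cont c_cont
    sigma_cont lam0 eig VC V_ge0 V01 VG).
have [ms [Mms Fms Rms]] := optimal_measure oQ conQ bndQ Q0 bdQ cK b_cont c_cont
  sigma_cont lam0 eig VC V_ge0 V01 VG.
have mD := @measurable_Dom R d K Q.
have mA g : C2g g -> measurable_fun (Dom K Q : set (BorelX R d K)) (Aop sigma b g).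
  by move=> [gC _]; apply: measurable_within_Dom; exact: within_Dom_Aop.
have mR : measurable_fun (Dom K Q : set (BorelX R d K)) (Rcost sigma c).
  by apply: measurable_within_Dom; exact: within_Dom_Rcost.
have FU mu : P mu -> (F (log_eigenfunction V) mu <= rho%:E)%E.
  move=> Pmu.
  have <- : (\int[mu]_(z in Dom K Q) (cst rho z)%:E = rho%:E)%E.
    by rewrite (integral_cst mu mD rho%:E) [X in (_ * X)%E]Pmu mule1.
  apply: le_integral_measurable => //.
  by apply: measurable_funD => //; exact: mA.
have MP : M `<=` P by move=> mu [].
(* The saddle inequalities, [F <= rho] at [ln V] for every measure and [F = rho] at [ms] for every
   [g], settle both orders of infimum and supremum for any set of measures between the singleton of
   [ms] and [P]. *)
have minmax (X : set (probability (BorelX R d K) R)) : X ms -> X `<=` P ->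
    rho%:E = ereal_inf [set ereal_sup [set F g mu | mu in X] | g in C2g] /\
    rho%:E = ereal_sup [set ereal_inf [set F g mu | g in C2g] | mu in X].
  move=> Xms XP; split; apply/eqP; rewrite eq_le; apply/andP; split.
  - apply: le_ereal_inf_tmp => _ [g gC <-].
    by rewrite -(Fms g gC); apply: ereal_sup_ubound; exists ms.
  - apply: ge_ereal_inf; eexists; first by exists (log_eigenfunction V).
    by apply: ge_ereal_sup => _ [mu Xmu <-]; apply: FU; exact: XP.
  - apply: le_ereal_sup_tmp; eexists; first by exists ms.
    by apply: le_ereal_inf_tmp => _ [g gC <-]; rewrite /F Fms.
  - apply: ge_ereal_sup => _ [mu Xmu <-].
    apply: le_trans (FU mu (XP _ Xmu)).
    by apply: ereal_inf_lbound; exists (log_eigenfunction V).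
have [P1 P2] := minmax P (MP _ Mms) (fun _ => id).
have [M1 M2] := minmax M Mms MP.
split=> //; apply/eqP; rewrite eq_le; apply/andP; split.
  by rewrite -Rms; apply: ereal_sup_ubound; exists ms.
apply: ge_ereal_sup => _ [mu Mmu <-].
(* For [mu] in [M] the function [A u], with [u = ln V], has integral 0, so the right side of
   [R <= rho - A u] integrates to [rho]. Comparing integrals, rather than splitting [F], allows the
   integral of the cost to be [-oo]. *)
have [Pmu /(_ _ UC)[fin0 int0]] := Mmu.
have iA : mu.-integrable (Dom K Q : set (BorelX R d K))
    (EFin \o Aop sigma b (log_eigenfunction V)).
  apply/integrableP; split; first by apply/measurable_EFinP; exact: mA.
  by under eq_integral do rewrite /=.
have iNA : mu.-integrable (Dom K Q : set (BorelX R d K))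
    (EFin \o (fun z => -1 * Aop sigma b (log_eigenfunction V) z)).
  exact: (integrableZl mD (-1) iA).
have i0 : (\int[mu]_(z in Dom K Q)
    (-1 * Aop sigma b (log_eigenfunction V) z)%:E = 0)%E.
  under eq_integral do rewrite EFinM.
  by rewrite (integralZl mD iA) [X in (_ * X)%E]int0 mule0.
rewrite -(integral_affine rho mD Pmu iNA i0).
apply: le_integral_measurable => //.
  apply: measurable_funD => //; apply: measurable_funM => //; exact: mA.
by move=> z Dz; have := AR_le z Dz; lra.
Qed.
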